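(* The distribution $\mathcal L\to\mathfrak D^{(m)}_{\mathrm{KZ}}$ is invariant with respect to the KZ connection: if $s(z)$ is a local section of $\mathcal L\to\mathfrak D^{(m)}_{\mathrm{KZ}}$, then the sections $\nabla_i^{\mathrm{KZ}}s(z)$, $i=1,\dots,n$, are also local sections of $\mathcal L\to\mathfrak D^{(m)}_{\mathrm{KZ}}$ (here $\nabla_i^{\mathrm{KZ}}s$ is considered where $\nabla_i^{\mathrm{KZ}}$ is defined, i.e. away from the diagonal hyperplanes $z_i=z_j$).
   Context: Let $p>q$ be prime numbers, $p$ odd, and let $e$ be the order of $p$ modulo $q$ (the least positive integer with $p^e\equiv1\pmod q$). Let $g$ be a positive integer and $n=gq+1$. Assume $p^e>n$ and $p\ge n+q-2$. Let $t$ be one variable and $z=(z_1,\dots,z_n)$. For $s\ge1$ put $\Phi_s(t,z)=\big((t-z_1)\cdots(t-z_n)\big)^{(p^{es}-1)/q}$. Let $A(\Phi_s(t,z))$ be the $g\times g$ matrix whose $(u,v)$ entry, $u,v=1,\dots,g$, is the coefficient of $t^{p^{es}v-u}$ in $\Phi_s(t,z)$; its entries are in $\mathbb Z[z]$. Let $I_s(z)$ be the $n\times g$ matrix whose entry in row $i$ and column $\ell$ is the coefficient of $t^{\ell p^{es}-1}$ in $\Phi_s(t,z)/(t-z_i)$. Let $m$ be a positive integer, $\mathbb Q_p^{(m)}$ the unramified extension of $\mathbb Q_p$ of degree $m$, $\mathbb Z_p^{(m)}$ its ring of integers, and $|\cdot|_p$ the extension of the $p$-adic norm. Put $\mathfrak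 D^{(m)}_{\mathrm{KZ}}=\{a\in(\mathbb Z_p^{(m)})^n : |\det A(\Phi_1(t,a))|_p=1\}$. Assume $p^m>d_\Phi$, where $d_\Phi=\frac{p^e-1}{q}\cdot\frac{qg^2+2g-qg}{2}$ is the degree of $\det A(\Phi_1(t,z))$ (this makes the domain nonempty). A function on this domain is analytic if on each unit polydisc $\{|z_j-\tilde u_j|_p<1,\ j=1,\dots,n\}$ contained in the domain it is given by a convergent power series. The $n\times g$ matrices $I_s(z)\,A(\Phi_s(t,z))^{-1}$ have entries that are rational functions regular on $\mathfrak D^{(m)}_{\mathrm{KZ}}$, and they converge uniformly there as $s\to\infty$ to an analytic $n\times g$ matrix denoted $\mathcal I(z)$, with columns $\mathcal I_1(z),\dots,\mathcal I_g(z)$. Let $W=\{(I_1,\dots,I_n)\in(\mathbb Q_p^{(m)})^n : I_1+\dots+I_n=0\}$ (column vectors). For $a\in\mathfrak D^{(m)}_{\mathrm{KZ}}$ let $\mathcal L_a\subset W$ be the $\mathbb Q_p^{(m)}$-subspace spanned by the columns of $\mathcal I(a)$. Let $\mathcal L=\bigcup_a\mathcal L_a\to\mathfrak D^{(m)}_{\mathrm{KZ}}$ be the resulting analytic distribution of subspaces in the fibers of the trivial bundle $W\times\mathfrak D^{(m)}_{\mathrm{KZ}}$. A local section of $\mathcal L$ is a local function of the form $\sum_{j=1}^g c_j(z)\mathcal I_j(z)$ with analytic functions $c_j(z)$. The KZ connection is given by $\nabla^{\mathrm{KZ}}_i=\frac{\partial}{\partial z_i}-H_i(z)$ with $H_i(z)=\frac1q\sum_{j\ne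 i}\frac{\Omega_{ij}}{z_i-z_j}$, $i=1,\dots,n$, where $\Omega_{ij}$ is the $n\times n$ matrix with entries $-1$ at positions $(i,i)$ and $(j,j)$, $1$ at positions $(i,j)$ and $(j,i)$, and $0$ elsewhere. *)

(* Defs.v *)
From mathcomp Require Import all_boot all_order all_algebra fieldext.
From mathcomp Require Import finmap.
From mathcomp Require Import boolp classical_sets reals.

Set Implicit Arguments.
Unset Strict Implicit.
Unset Printing Implicit Defensive.

Import Order.TTheory GRing.Theory Num.Theory.

Local Open Scope classical_set_scope.
Local Open Scope ring_scope.

Record nonarch_absval (R : realType) (K : fieldType) := NonarchAbsval {
  absval_fun :> K -> R;
  absval_ge0 : forall x, 0 <= absval_fun x;
  absval_eq0 : forall x, (absval_fun x == 0) = (x == 0);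
  absvalM : forall x y, absval_fun (x * y) = absval_fun x * absval_fun y;
  absvalD : forall x y,
    absval_fun (x + y) <= Num.max (absval_fun x) (absval_fun y) }.

Definition abs_cvg (R : realType) (K : fieldType) (abs : nonarch_absval R K)
    (x : nat -> K) (l : K) : Prop :=
  forall eps : R, 0 < eps ->
    exists N : nat, forall k : nat, (N <= k)%N -> abs (x k - l) < eps.

Definition abs_cauchy (R : realType) (K : fieldType) (abs : nonarch_absval R K)
    (x : nat -> K) : Prop :=
  forall eps : R, 0 < eps -> exists N : nat,
    forall k l : nat, (N <= k)%N -> (N <= l)%N -> abs (x k - x l) < eps.

(* The limit when it exists (it is then unique), and 0 otherwise. *)
Definition abs_lim (R : realType) (K : fieldType) (abs : nonarch_absval R K)
    (x : nat -> K) : K :=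
  xget 0 [set l | abs_cvg abs x l].

Definition padic_norm (R : realType) (p : nat) (x : rat) : R :=
  if x == 0 then 0
  else p%:R ^ ((logn p `|denq x|)%:Z - (logn p `|numq x|)%:Z).

(* (F, abs) is the completion of the rationals for the p-adic norm; this
   determines it up to a unique isometric isomorphism. *)
Record is_Qp (R : realType) (p : nat) (F : fieldType)
    (abs : nonarch_absval R F) : Prop := IsQp {
  Qp_norm : forall x : rat, abs (ratr x) = padic_norm R p x;
  Qp_dense : forall (x : F) (eps : R), 0 < eps ->
    exists y : rat, abs (x - ratr y) < eps;
  Qp_complete : forall x : nat -> F, abs_cauchy abs x ->
    exists l : F, abs_cvg abs x l }.

(* K is the unramified extension of degree m of F, with absolute value absK:
   absK extends absF, and the ramification index, i.e. the index of the value
   group of F in that of K, is 1. *)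
Record is_unramified_ext (R : realType) (F : fieldType)
    (absF : nonarch_absval R F) (K : fieldExtType F)
    (absK : nonarch_absval R K) (m : nat) : Prop := IsUnramifiedExt {
  unram_degree : \dim {:K} = m;
  unram_extends : forall x : F, absK x%:A = absF x;
  unram_value_group : forall x : K, exists y : F, absK x = absF y }.

Definition Phi (p q e n s : nat) (A : comNzRingType) (z : 'rV[A]_n) : {poly A} :=
  (\prod_(i < n) ('X - (z 0 i)%:P)) ^+ ((p ^ (e * s) - 1) %/ q)%N.

(* Ordinals start at 0, so that the indices u, v = 1, ..., g of the usual
   notation are u.+1, v.+1 here, and similarly in Imx. *)
Definition Amx (p q e n g s : nat) (A : comNzRingType) (z : 'rV[A]_n) : 'M[A]_g :=
  \matrix_(u, v) (Phi p q e s z)`_(p ^ (e * s) * v.+1 - u.+1)%N.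

(* For s >= 1 the division is exact. *)
Definition Imx (p q e n g s : nat) (K : fieldType) (z : 'rV[K]_n) : 'M[K]_(n, g) :=
  \matrix_(i, l) (Phi p q e s z %/ ('X - (z 0 i)%:P))`_(l.+1 * p ^ (e * s) - 1)%N.

Definition deg_detA (p q e g : nat) : nat :=
  ((p ^ e - 1) %/ q * ((q * g ^ 2 + 2 * g - q * g) %/ 2))%N.

Definition D_KZ (p q e n g : nat) (R : realType) (K : fieldType)
    (abs : nonarch_absval R K) : set 'rV[K]_n :=
  [set a : 'rV[K]_n | (forall j, abs (a 0 j) <= 1) /\ abs (\det (Amx p q e g 1 a)) = 1].

(* The sequence converges uniformly on D_KZ, so the entrywise pointwise limit
   is the uniform one; the values outside D_KZ are irrelevant. *)
Definition Ilim (p q e n g : nat) (R : realType) (K : fieldType)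
    (abs : nonarch_absval R K) (z : 'rV[K]_n) : 'M[K]_(n, g) :=
  \matrix_(i, l) abs_lim abs
    (fun s => (Imx p q e g s z *m invmx (Amx p q e g s z)) i l).

Definition polydisc (n : nat) (R : realType) (K : fieldType)
    (abs : nonarch_absval R K) (u : 'rV[K]_n) (r : R) : set 'rV[K]_n :=
  [set z : 'rV[K]_n | forall j, abs (z 0 j - u 0 j) < r].

Definition abs_open (n : nat) (R : realType) (K : fieldType)
    (abs : nonarch_absval R K) (U : set 'rV[K]_n) : Prop :=
  forall u, U u -> exists r : R, 0 < r /\ polydisc abs u r `<=` U.

(* The power series centred at u with coefficients c, indexed by the
   multi-exponents in nat^n, converges (unconditionally) at z to l. *)
Definition power_series_sum (n : nat) (R : realType) (K : fieldType)
    (abs : nonarch_absval R K) (c : {ffun 'I_n -> nat} -> K)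
    (u z : 'rV[K]_n) (l : K) : Prop :=
  forall eps : R, 0 < eps -> exists J : {fset {ffun 'I_n -> nat}},
    forall J' : {fset {ffun 'I_n -> nat}}, fsubset J J' ->
      abs (\sum_(k <- J') c k * \prod_j (z 0 j - u 0 j) ^+ k j - l) < eps.

(* On a set of integral points that is a union of unit polydiscs this says
   that f is given by a convergent power series on each of these; smaller
   polydiscs are allowed so that the notion makes sense on every open subset,
   e.g. on the complement of the diagonals. Every point of a polydisc is a
   centre of it. *)
Definition analytic_on (n : nat) (R : realType) (K : fieldType)
    (abs : nonarch_absval R K) (U : set 'rV[K]_n) (f : 'rV[K]_n -> K) : Prop :=
  forall (u : 'rV[K]_n) (r : R), 0 < r <= 1 -> polydisc abs u r `<=` U ->
    exists c : {ffun 'I_n -> nat} -> K, forall z, polydisc abs u r z ->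
      power_series_sum abs c u z (f z).

Definition is_pderiv (n : nat) (R : realType) (K : fieldType)
    (abs : nonarch_absval R K) (i : 'I_n) (f : 'rV[K]_n -> K)
    (a : 'rV[K]_n) (l : K) : Prop :=
  forall eps : R, 0 < eps -> exists2 delta : R, 0 < delta &
    forall h : K, h != 0 -> abs h < delta ->
      abs ((f (a + h *: delta_mx 0 i) - f a) / h - l) < eps.

(* The partial derivative when it exists, and 0 otherwise. *)
Definition pderiv (n : nat) (R : realType) (K : fieldType)
    (abs : nonarch_absval R K) (i : 'I_n) (f : 'rV[K]_n -> K)
    (a : 'rV[K]_n) : K :=
  xget 0 [set l | is_pderiv abs i f a l].

Definition Omega (n : nat) (A : nzRingType) (i j : 'I_n) : 'M[A]_n :=
  delta_mx i j + delta_mx j i - delta_mx i i - delta_mx j j.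

Definition H_KZ (q n : nat) (K : fieldType) (i : 'I_n) (z : 'rV[K]_n) : 'M[K]_n :=
  q%:R^-1 *: \sum_(j < n | j != i) (z 0 i - z 0 j)^-1 *: Omega K i j.

Definition nabla_KZ (q n : nat) (R : realType) (K : fieldType)
    (abs : nonarch_absval R K) (i : 'I_n) (s : 'rV[K]_n -> 'cV[K]_n)
    (z : 'rV[K]_n) : 'cV[K]_n :=
  \col_k pderiv abs i (fun y => s y k 0) z - H_KZ q i z *m s z.

Definition regular_KZ (n : nat) (K : fieldType) (i : 'I_n) : set 'rV[K]_n :=
  [set z : 'rV[K]_n | forall j, j != i -> z 0 i != z 0 j].

(* s is a local section over U; its values outside U are irrelevant. *)
Definition local_section (p q e n g : nat) (R : realType) (K : fieldType)
    (abs : nonarch_absval R K) (U : set 'rV[K]_n)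
    (s : 'rV[K]_n -> 'cV[K]_n) : Prop :=
  [/\ U `<=` D_KZ p q e g abs, abs_open abs U &
      exists c : 'I_g -> 'rV[K]_n -> K,
        (forall j, analytic_on abs U (c j)) /\
        (forall z, U z -> s z = \sum_j c j z *: col j (Ilim p q e g abs z))].

(* Main.v *)
(** Write [P = p ^ e], [N_s = (P ^ s - 1) / q], [F = \prod_i (t - z_i)], so that
    [Phi_s = F ^ N_s], and let [X_s = I_s A_s^-1].

    Convergence. One has
    [j * (f ^ (p ^ k))_j = p ^ k * (f ^ (p ^ k - 1) * f')_(j-1)], so that the
    coefficient of [t ^ j] in [f ^ (p ^ k)] is divisible by [p ^ (k - v_p(j))].
    Applied to [Phi_s = Phi_i * (F ^ N_(s-i)) ^ (P ^ i)], this gives by induction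
    on [i] that the rows of [I_s - X_i A_s], extended to the coefficients of all
    degrees, are divisible by [p ^ i] in the degrees divisible by [P ^ i]; hence
    [X_s = X_i] modulo [p ^ i] for [i <= s]. Modulo [p] one has
    [det A_(s+1) = det A_1 * (det A_s) ^ P], so all [A_s] are invertible on the
    domain. This is pure algebra over a ring without [p]-torsion in which
    [1 + p b] is invertible. Over the ring of integral restricted power series on
    a polydisc it yields an analytic limit.

    Connection. The matrix [d_i A_s] can be expressed with [A_s] and the [i]-th
    row of [I_s] by expanding [Phi_s / (t - z_i)] in terms of [Phi_s], and
    [d_i I_s] equals [H_i I_s] up to a multiple of [P ^ s], the [i]-th row being
    controlled by the coefficients of [d Phi_s / d t]. Since [- N_s] tends to
    [1 / q], the limit satisfies [d_i I = H_i I - I B] with [B] a polynomial in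
    [z] and the entries of [I]. So [nabla_i] maps [\sum_j c_j I_j] to
    [\sum_j (d_i c_j - \sum_l B_jl c_l) I_j]. *)

From HB Require Import structures.
Require Import Defs.
From mathcomp Require Import all_boot all_order all_algebra fieldext.
From mathcomp Require Import boolp classical_sets functions reals.
From mathcomp Require Import finmap mpoly ring.
From mathcomp Require Import zify lra.

Set Implicit Arguments.
Unset Strict Implicit.
Unset Printing Implicit Defensive.

Import Order.TTheory GRing.Theory Num.Theory.

Local Open Scope classical_set_scope.
Local Open Scope ring_scope.

(** * Divisibility in commutative rings *)

(** Limit and derivative are exchanged without differentiating series term by term. For each [s],
    the first-order expansion of [I_s A_s^-1] in [z_i] has an error of at most [|h|^2], with no
    constant depending on [s]; the bound therefore survives the limit and determines the derivative
    there. This uniformity comes from integrality: every Taylor remainder has coefficients in the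
    ring of integers, and [A_s^-1] is integral because [det A_s] is a unit. The poles
    [1 / (z_i - z_j)] do no harm, since at level [s] they only rewrite the integral coefficients of
    [Phi_s / ((t - z_i) (t - z_j))].

    Unramifiedness makes the value group [p^Z]. An open polydisc of radius at most 1 is thus the set
    of points [u + pi w], with [w] in the closed unit polydisc and [pi] a power of [p] with
    [|pi| <= |p|]. Its points are congruent to [u] modulo [p], so [det A_1] stays invertible and the
    congruences can be run once, over the restricted power series in [w]. *)

Section Divisibility.
Variable B : comNzRingType.
Implicit Types a x y : B.

Definition dvr a x := exists b, x = a * b.

Lemma dvr0 a : dvr a 0. Proof. by exists 0; rewrite mulr0. Qed.

Lemma dvr1 x : dvr 1 x. Proof. by exists x; rewrite mul1r. Qed.

Lemma dvrD a x y : dvr a x -> dvr a y -> dvr a (x + y).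
Proof. by move=> [b ->] [c ->]; exists (b + c); rewrite mulrDr. Qed.

Lemma dvrN a x : dvr a x -> dvr a (- x).
Proof. by move=> [b ->]; exists (- b); rewrite mulrN. Qed.

Lemma dvrB a x y : dvr a x -> dvr a y -> dvr a (x - y).
Proof. by move=> ax ay; apply: dvrD => //; exact: dvrN. Qed.

Lemma dvr_mull a x y : dvr a x -> dvr a (y * x).
Proof. by move=> [b ->]; exists (y * b); rewrite mulrCA. Qed.

Lemma dvr_mulr a x y : dvr a x -> dvr a (x * y).
Proof. by rewrite mulrC; exact: dvr_mull. Qed.

Lemma dvrM a b x y : dvr a x -> dvr b y -> dvr (a * b) (x * y).
Proof. by move=> [c ->] [d ->]; exists (c * d); rewrite mulrACA. Qed.

Lemma dvr_sum a (I : Type) (r : seq I) (Q : pred I) (f : I -> B) :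
  (forall i, Q i -> dvr a (f i)) -> dvr a (\sum_(i <- r | Q i) f i).
Proof. by move=> af; elim/big_ind: _ => //; [exact: dvr0 | exact: dvrD]. Qed.

Lemma dvr_exp_le a x m k : (m <= k)%N -> dvr (a ^+ k) x -> dvr (a ^+ m) x.
Proof.
by move=> mk [b ->]; exists (a ^+ (k - m) * b); rewrite mulrA -exprD subnKC.
Qed.

Definition eqmodr a x y := dvr a (x - y).

Lemma eqmodr_refl a x : eqmodr a x x.
Proof. by rewrite /eqmodr subrr; exact: dvr0. Qed.

Lemma eqmodr_sym a x y : eqmodr a x y -> eqmodr a y x.
Proof. by move=> /dvrN; rewrite opprB. Qed.

Lemma eqmodr_trans a y x z : eqmodr a x y -> eqmodr a y z -> eqmodr a x z.
Proof. by move=> xy yz; have := dvrD xy yz; rewrite addrA subrK. Qed.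

Lemma eqmodrD a x y z t :
  eqmodr a x y -> eqmodr a z t -> eqmodr a (x + z) (y + t).
Proof. by move=> xy zt; have := dvrD xy zt; rewrite /eqmodr opprD addrACA. Qed.

Lemma eqmodrM a x y z t :
  eqmodr a x y -> eqmodr a z t -> eqmodr a (x * z) (y * t).
Proof.
move=> xy zt; have := dvrD (dvr_mulr z xy) (dvr_mull y zt).
by rewrite /eqmodr mulrBl mulrBr addrA subrK.
Qed.

Lemma eqmodr_sum a (I : Type) (r : seq I) (Q : pred I) (f h : I -> B) :
  (forall i, Q i -> eqmodr a (f i) (h i)) ->
  eqmodr a (\sum_(i <- r | Q i) f i) (\sum_(i <- r | Q i) h i).
Proof.
move=> fh; elim/big_ind2: _ => //; first exact: eqmodr_refl.
by move=> *; exact: eqmodrD.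
Qed.

Lemma eqmodr_prod a (I : Type) (r : seq I) (Q : pred I) (f h : I -> B) :
  (forall i, Q i -> eqmodr a (f i) (h i)) ->
  eqmodr a (\prod_(i <- r | Q i) f i) (\prod_(i <- r | Q i) h i).
Proof.
move=> fh; elim/big_ind2: _ => //; first exact: eqmodr_refl.
by move=> *; exact: eqmodrM.
Qed.

Lemma eqmodrX a x y k : eqmodr a x y -> eqmodr a (x ^+ k) (y ^+ k).
Proof.
move=> xy; elim: k => [|k IHk]; first exact: eqmodr_refl.
by rewrite !exprS; exact: eqmodrM.
Qed.

Lemma eqmodr_det a g (M L : 'M[B]_g) :
  (forall i j, eqmodr a (M i j) (L i j)) -> eqmodr a (\det M) (\det L).
Proof.
move=> ML; apply: eqmodr_sum => s _; apply: eqmodrM; first exact: eqmodr_refl.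
by apply: eqmodr_prod => i _.
Qed.

Lemma eqmodr_expD p x y : prime p ->
  eqmodr p%:R ((x + y) ^+ p) (x ^+ p + y ^+ p).
Proof.
case: p => // p pr_p; rewrite /eqmodr exprDn big_ord_recl big_ord_recr /=.
rewrite [bump 0 p]add1n bin0 binn subn0 subnn !expr0 mulr1 mul1r !mulr1n [X in
  _ + X - _]addrC.
rewrite addrA [_ - _]addrC addKr; apply: dvr_sum => i _.
rewrite -[X in dvr _ X]mulr_natl; apply: dvr_mulr.
have /dvdnP[k ->] : (p.+1 %| 'C(p.+1, bump 0 i))%N.
  by apply: prime_dvd_bin => //; rewrite /bump leq0n add1n /= ltnS ltn_ord.
by exists k%:R; rewrite mulrC natrM.
Qed.

Lemma eqmodr_exp_sum p (I : Type) (r : seq I) (f : I -> B) : prime p ->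
  eqmodr p%:R ((\sum_(i <- r) f i) ^+ p) (\sum_(i <- r) f i ^+ p).
Proof.
move=> pr_p; elim: r => [|i r IHr].
  by rewrite !big_nil expr0n eqn0Ngt prime_gt0//; exact: eqmodr_refl.
rewrite !big_cons; apply: (eqmodr_trans (eqmodr_expD _ _ pr_p)).
by apply: eqmodrD => //; exact: eqmodr_refl.
Qed.

(** Frobenius is additive modulo [p], hence compatible with the Leibniz expansion; [p] odd makes
    each sign its own [p]-th power. *)
Lemma eqmodr_det_exp p k g (M : 'M[B]_g) : prime p -> odd p ->
  eqmodr p%:R (\det (map_mx (fun x => x ^+ (p ^ k)) M)) (\det M ^+ (p ^ k)).
Proof.
move=> pr_p odd_p; elim: k => [|k IHk].
  have -> : map_mx (fun x => x ^+ (p ^ 0)) M = M.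
    by apply/matrixP => i j; rewrite mxE expr1.
  by rewrite expr1; exact: eqmodr_refl.
rewrite expnSr exprM; apply: eqmodr_trans (eqmodrX p IHk).
apply: eqmodr_sym; apply: eqmodr_trans (eqmodr_exp_sum _ _ pr_p) _.
apply: eqmodr_sum => s _; rewrite exprMn -exprM mulnC exprM -(signr_odd B p)
  odd_p.
rewrite expr1 -prodrXl; under eq_bigr do rewrite mxE.
under [in X in eqmodr _ _ X]eq_bigr do rewrite mxE exprM.
exact: eqmodr_refl.
Qed.

End Divisibility.

(** * Coefficients of powers of polynomials with exponent a power of [p] *)

Section Coefficients.
Variables (B : comNzRingType) (p : nat).
Hypothesis pr_p : prime p.
Implicit Types f h : {poly B}.

Lemma dvr_coef a f j : dvr a%:P f -> dvr a f`_j.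
Proof. by move=> [h ->]; rewrite coefCM; exists h`_j. Qed.

Lemma eqmodr_coef a f h j : eqmodr a%:P f h -> eqmodr a f`_j h`_j.
Proof. by move=> /dvr_coef; rewrite /eqmodr => /(_ j); rewrite coefB. Qed.

Lemma coef_exp_prime f j : eqmodr p%:R (f ^+ p)`_(j * p) (f`_j ^+ p).
Proof.
elim/poly_ind: f j => [|f c IHf] j.
  by rewrite coef0 !expr0n [p == 0]eqn0Ngt prime_gt0// coef0;
    exact: eqmodr_refl.
have := eqmodr_expD (f * 'X) c%:P pr_p.
rewrite -polyC_natr => /eqmodr_coef => /(_ (j * p)%N) /eqmodr_trans; apply.
rewrite exprMn coefD coefMXn -polyC_exp coefC coefD coefMX coefC muln_eq0.
rewrite [p == 0]eqn0Ngt prime_gt0//= orbF; case: j => [|j] /=.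
  by rewrite mul0n prime_gt0// !add0r; exact: eqmodr_refl.
by rewrite ltnNge leq_pmull// mulSn addKn !addr0.
Qed.

Lemma coef_exp_primeX k f j :
  eqmodr p%:R (f ^+ (p ^ k))`_(j * p ^ k) (f`_j ^+ (p ^ k)).
Proof.
elim: k j => [|k IHk] j; first by rewrite muln1 !expr1; exact: eqmodr_refl.
rewrite expnSr mulnA !exprM; apply: eqmodr_trans (coef_exp_prime _ _) _.
exact: eqmodrX.
Qed.

Hypothesis p_reg : forall x : B, p%:R * x = 0 -> x = 0.

Lemma preg_exp k (x : B) : p%:R ^+ k * x = 0 -> x = 0.
Proof.
by elim: k => [|k IHk]; rewrite ?mul1r// exprS -mulrA => /p_reg.
Qed.

(* From j * (f^N)_j = N * (f^(N-1) f')_(j-1) with N = p^k. *)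
Lemma dvr_coef_exp k f j v : ~~ (p ^ v.+1 %| j)%N ->
  dvr (p%:R ^+ (k - v)) (f ^+ (p ^ k))`_j.
Proof.
move=> ndvd; have j_gt0 : (0 < j)%N by case: j ndvd => //; rewrite dvdn0.
have [c c_coprime jE] := pfactor_coprime pr_p j_gt0; set w := logn p j in jE.
have wv : (w <= v)%N by rewrite leqNgt -pfactor_dvdn.
apply: (@dvr_exp_le _ _ _ _ (k - w)); first exact: leq_sub2l.
have [kw|wk] := leqP k w; first by rewrite (eqP kw); exact: dvr1.
have : (f ^+ (p ^ k))`_j *+ j = p%:R ^+ k * (f^`() * f ^+ (p ^ k).-1)`_j.-1.
  by rewrite -[in LHS](prednK j_gt0) -coef_deriv deriv_exp coefMn -natrX
    mulr_natl.
move: (_`_j.-1) => y; move: (_`_j) => x.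
(* With [j = c p^w], the factor [p^w] is cancelled on both sides, leaving [c x] divisible by
   [p^(k - w)]. *)
rewrite [in X in X -> _]jE -[x *+ _]mulr_natl natrM natrX [c%:R * _]mulrC
  -{1}(subnKC (ltnW wk)) exprD -!mulrA.
move=> /eqP; rewrite -subr_eq0 -mulrBr => /eqP /preg_exp /eqP.
rewrite subr_eq0 => /eqP cx.
have c_gt0 : (0 < c)%N by move: j_gt0; rewrite jE muln_gt0 => /andP[].
have /(coprimeXr (k - w)) : coprime c p by rewrite coprime_sym.
rewrite /coprime => /eqP gcdE.
have [a b abE _] := egcdnP (p ^ (k - w)) c_gt0.
(* As [c] is prime to [p], the Bezout relation [a c = b p^(k - w) + 1] removes the factor [c]. *)
rewrite gcdE in abE.
have : a%:R * (c%:R * x) = b%:R * p%:R ^+ (k - w) * x + x.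
  by rewrite mulrA -natrM abE natrD natrM natrX mulrDl mul1r.
rewrite cx => xE; rewrite -[x](addKr (b%:R * p%:R ^+ (k - w) * x)) -xE addrC.
apply: dvrB; first by apply/dvr_mull/dvr_mulr; exists 1; rewrite mulr1.
by rewrite mulrAC mulrC; apply: dvr_mulr; exists 1; rewrite mulr1.
Qed.

End Coefficients.

Lemma sum_multiples (V : nmodType) (F : nat -> V) D M : (0 < D)%N ->
  \sum_(j < (D * M).+1 | (D %| j)%N) F j = \sum_(w < M.+1) F (D * w)%N.
Proof.
move=> D_gt0; have ltD (w : 'I_M.+1) : (D * w < (D * M).+1)%N.
  by rewrite ltnS leq_pmul2l// -ltnS.
rewrite (reindex_onto (fun w => Ordinal (ltD w)) (fun j => inord (j %/ D))).
  by apply: eq_big => //= w; rewrite dvdn_mulr//= mulKn// inord_val eqxx.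
move=> j /= /divnK jD; apply: val_inj => /=; rewrite inordK.
  by rewrite mulnC jD.
have jDM : (j <= D * M)%N by rewrite -ltnS.
by rewrite ltnS -[X in (_ <= X)%N](mulKn M D_gt0) leq_div2r.
Qed.

(** The count of factors [p] that closes the induction in [dvrG]. With [v = a e + b] it reads
    [b <= (e - 1) (i - a)], true since [b < e] and [a < i]. *)
Lemma leq_divn_sub e i v : (0 < e)%N -> (v < e * i)%N ->
  (i <= v %/ e + (e * i - v))%N.
Proof.
move=> e_gt0; rewrite mulnC -ltn_divLR// => lt_i.
have [d ->] : exists d, i = (v %/ e + d.+1)%N.
  by exists (i - (v %/ e).+1)%N; rewrite addnS -addSn subnKC.
rewrite leq_add2l leq_subRL; last first.
  by rewrite {1}(divn_eq v e) mulnDl mulSn leq_add2l ltnW// ltn_addr// ltn_pmod.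
rewrite {1}(divn_eq v e) mulnDl -addnA leq_add2l mulSn.
by rewrite -addSnnS leq_add ?leq_pmulr// ltn_pmod.
Qed.

Section CoefficientsOfProducts.
Variables (B : comNzRingType) (a : B) (f h : {poly B}) (D M : nat).
Hypothesis D_gt0 : (0 < D)%N.

Lemma eqmodr_coefM_multiples :
    (forall j, ~~ (D %| j)%N -> dvr a h`_j) ->
  eqmodr a (f * h)`_(D * M) (\sum_(w < M.+1) f`_(D * w) * h`_(D * (M - w))).
Proof.
move=> ndh; rewrite coefM (bigID (fun j : 'I_ _ => D %| j)%N) /=.
rewrite (sum_multiples (fun j => f`_j * h`_(D * M - j)) _ D_gt0).
under [X in eqmodr _ _ X]eq_bigr do rewrite mulnBr.
rewrite /eqmodr [X in dvr _ (X - _)]addrC addrK.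
apply: dvr_sum => j ndj; apply/dvr_mull/ndh; apply: contra ndj => dj.
have le_j : (j <= D * M)%N by rewrite -ltnS.
by rewrite -(subKn le_j) dvdn_sub// dvdn_mulr.
Qed.

End CoefficientsOfProducts.

(** * The congruence for the hypergeometric matrices *)

Section Exponents.
Variables (p q e : nat).
Hypotheses (p_gt1 : (1 < p)%N) (q_gt1 : (1 < q)%N) (e_gt0 : (0 < e)%N).
Hypothesis (e_order : p ^ e = 1 %[mod q]).

Definition expo s := ((p ^ (e * s) - 1) %/ q)%N.

Lemma expoK s : (expo s * q)%N = (p ^ (e * s) - 1)%N.
Proof.
apply: divnK; rewrite -eqn_mod_dvd ?expn_gt0 ?(ltnW p_gt1)// expnM -modnXm.
by rewrite e_order modnXm exp1n.
Qed.

Lemma expo_gt0 s : (0 < s)%N -> (0 < expo s)%N.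
Proof.
move=> s_gt0; have := expoK s; case: (expo s) => // /esym/eqP.
by rewrite mul0n subn_eq0 leqNgt -{1}(expn0 p) ltn_exp2l// muln_gt0 e_gt0 s_gt0.
Qed.

Lemma expo_lt s : (expo s < p ^ (e * s))%N.
Proof.
rewrite (@leq_ltn_trans (p ^ (e * s) - 1))//; last first.
  by rewrite ltn_subrL expn_gt0 (ltnW p_gt1).
by rewrite -expoK leq_pmulr// ltnW.
Qed.

(** This additivity is what splits off a [P^i]-th power from [Phi_(i+s)]. *)
Lemma expoD i s : expo (i + s) = (expo i + p ^ (e * i) * expo s)%N.
Proof.
apply/eqP; rewrite -(eqn_pmul2r (ltnW q_gt1)) mulnDl -mulnA !expoK.
rewrite mulnDr expnD.
have := expn_gt0 p (e * i); have := expn_gt0 p (e * s).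
rewrite (ltnW p_gt1) /=; case: (p ^ (e * s))%N => // b _.
case: (p ^ (e * i))%N => // a _; rewrite !subn1 /= mulnS addnCA.
exact/eqP.
Qed.

End Exponents.

Definition root_poly n (A : comNzRingType) (z : 'rV[A]_n) : {poly A} :=
  \prod_(i < n) ('X - (z 0 i)%:P).

Definition root_polyD n (A : comNzRingType) (z : 'rV[A]_n) k : {poly A} :=
  \prod_(i < n | i != k) ('X - (z 0 i)%:P).

(* [Phi / ('X - z_k)] for [0 < s], over any commutative ring. *)
Definition PhiD p q e n s (A : comNzRingType) (z : 'rV[A]_n) k : {poly A} :=
  root_polyD z k * root_poly z ^+ (expo p q e s).-1.

(** [Imx] without polynomial division: it commutes with ring morphisms, so it can be formed over the
    restricted power series and then evaluated at points. *)
Definition Igen p q e n g s (A : comNzRingType) (z : 'rV[A]_n) : 'M[A]_(n, g) :=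
  \matrix_(k, l) (PhiD p q e s z k)`_(l.+1 * p ^ (e * s) - 1)%N.

Section Functoriality.
Variables (A B : comNzRingType) (f : {rmorphism A -> B}) (p q e g n s : nat).
Variable z : 'rV[A]_n.

Let map_XsubC i :
  map_poly f ('X - (z 0 i)%:P) = 'X - (map_mx f z 0 i)%:P.
Proof. by rewrite rmorphB /= map_polyX map_polyC mxE. Qed.

Lemma map_root_poly : map_poly f (root_poly z) = root_poly (map_mx f z).
Proof. by rewrite rmorph_prod; apply: eq_bigr => i _; exact: map_XsubC. Qed.

Lemma map_Phi : map_poly f (Phi p q e s z) = Phi p q e s (map_mx f z).
Proof. by rewrite rmorphXn /= map_root_poly. Qed.

Lemma map_PhiD k : map_poly f (PhiD p q e s z k) = PhiD p q e s (map_mx f z) k.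
Proof.
rewrite rmorphM rmorphXn /= map_root_poly rmorph_prod; congr (_ * _).
by apply: eq_bigr => i _; exact: map_XsubC.
Qed.

Lemma map_Amx : map_mx f (Amx p q e g s z) = Amx p q e g s (map_mx f z).
Proof. by apply/matrixP => u v; rewrite !mxE -map_Phi coef_map. Qed.

Lemma map_Igen : map_mx f (Igen p q e g s z) = Igen p q e g s (map_mx f z).
Proof. by apply/matrixP => k l; rewrite !mxE -map_PhiD coef_map. Qed.

End Functoriality.

Lemma eqmodr_Amx (B : comNzRingType) (a : B) p q e g n s (z z' : 'rV[B]_n) u v :
    (forall j, eqmodr a (z 0 j) (z' 0 j)) ->
  eqmodr a (Amx p q e g s z u v) (Amx p q e g s z' u v).
Proof.
move=> zz'; rewrite !mxE; apply/eqmodr_coef/eqmodrX/eqmodr_prod => i _.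
apply: eqmodrD; first exact: eqmodr_refl.
have [b zE] := zz' i; exists (- b)%:P.
by rewrite -polyCM mulrN -zE opprB polyCB opprK addrC.
Qed.

Section Hypergeometric.
Variables (B : comNzRingType) (p q e g n : nat).
Hypotheses (pr_p : prime p) (odd_p : odd p) (q_gt1 : (1 < q)%N).
Hypotheses (e_gt0 : (0 < e)%N) (e_order : p ^ e = 1 %[mod q]).
Hypotheses (n_def : n = (g * q + 1)%N) (n_lt_pe : (n < p ^ e)%N).
Implicit Types z : 'rV[B]_n.
Hypothesis p_reg : forall x : B, p%:R * x = 0 -> x = 0.

Let p_gt1 : (1 < p)%N := prime_gt1 pr_p.

Let P s := (p ^ (e * s))%N.

Let N s := expo p q e s.

Let P_gt0 s : (0 < P s)%N. Proof. by rewrite expn_gt0 ltnW. Qed.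

Let g_lt_P s : (0 < s)%N -> (g < P s)%N.
Proof.
move=> s_gt0; apply: (@leq_trans (p ^ e)).
  apply: leq_ltn_trans n_lt_pe; rewrite n_def addn1 leqW// leq_pmulr//.
  exact: ltnW.
by rewrite leq_exp2l// leq_pmulr.
Qed.

Lemma root_polyDE (A : comNzRingType) (z : 'rV[A]_n) k :
  ('X - (z 0 k)%:P) * root_polyD z k = root_poly z.
Proof. by rewrite [RHS](bigD1 k). Qed.

Lemma PhiDE s z k : (0 < s)%N ->
  ('X - (z 0 k)%:P) * PhiD p q e s z k = Phi p q e s z.
Proof.
move=> s_gt0; rewrite mulrA root_polyDE -exprS prednK//.
exact: expo_gt0.
Qed.

Lemma PhiS i s z :
  Phi p q e (i + s) z = Phi p q e i z * (root_poly z ^+ N s) ^+ P i.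
Proof. by rewrite /Phi -!/(expo _ _ _ _) expoD// exprD mulnC exprM. Qed.

Lemma PhiDS i s z k : (0 < i)%N ->
  PhiD p q e (i + s) z k = PhiD p q e i z k * (root_poly z ^+ N s) ^+ P i.
Proof.
move=> i_gt0; rewrite /PhiD -mulrA -exprM mulnC -exprD expoD//.
by congr (_ * _ ^+ _); move: (expo_gt0 p_gt1 e_gt0 e_order i_gt0); case: expo.
Qed.

Lemma size_root_poly z : size (root_poly z) = n.+1.
Proof. by rewrite /root_poly -(big_enum _ _ 'I_n) size_prod_XsubC
  size_enum_ord. Qed.

Lemma size_root_polyD z k : size (root_polyD z k) = n.
Proof.
have := size_root_poly z; rewrite -(root_polyDE z k) size_monicM.
- by rewrite size_XsubC => - [].
- exact: monicXsubC.
- by apply/monic_neq0/rpred_prod => i _; exact: monicXsubC.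
Qed.

(** As [n = g q + 1] and [q N_s = P^s - 1], the degree of [Phi_s] is [g (P^s - 1) + N_s], less than
    [(g + 1) P^s - g]. This is why [g] columns suffice. *)
Lemma Phi_coef_out s z w u : (u <= g)%N -> (g < w)%N ->
  (Phi p q e s z)`_(P s * w - u) = 0.
Proof.
move=> ug gw; rewrite nth_default//.
apply: leq_trans (size_poly_exp_leq _ _) _; rewrite size_root_poly /=.
rewrite -/(expo p q e s) n_def mulnDl mul1n -mulnA [(q * _)%N]mulnC.
rewrite (expoK p_gt1 e_order) -/(P s).
have := expo_lt p_gt1 q_gt1 e_order s; rewrite -/(P s).
have := P_gt0 s; have := leq_mul (leqnn (P s)) gw; nia.
Qed.

(** The factor [X^(u+1)] brings the entries of all rows to degrees divisible by [P^s], where the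
    congruences hold. *)
Lemma coef_Amx s z (u v : 'I_g) : (0 < s)%N ->
  ('X^(u.+1) * Phi p q e s z)`_(P s * v.+1) = Amx p q e g s z u v.
Proof.
move=> s_gt0; rewrite coefXnM mxE ifF// ltnNge; apply/negbF.
by rewrite (@leq_trans (P s))// ?leq_pmulr// (leq_trans _ (g_lt_P s_gt0))//
  ltnW// ltnS.
Qed.

Lemma coef_Amx_out s z (u : 'I_g) w : (w == 0) || (g < w)%N ->
  ('X^(u.+1) * Phi p q e s z)`_(P s * w) = 0.
Proof.
case/orP => [/eqP ->|gw]; first by rewrite muln0 coefXnM.
by rewrite coefXnM Phi_coef_out// if_same.
Qed.

Lemma coef_Igen s z k (l : 'I_g) :
  ('X * PhiD p q e s z k)`_(P s * l.+1) = Igen p q e g s z k l.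
Proof. by rewrite coefXM mxE muln_eq0 -subn1 mulnC eqn0Ngt P_gt0. Qed.

Lemma coef_Igen_out s z k w : (0 < s)%N -> (w == 0) || (g < w)%N ->
  ('X * PhiD p q e s z k)`_(P s * w) = 0.
Proof.
move=> s_gt0 /orP[/eqP ->|gw]; first by rewrite muln0 coefXM.
rewrite coefXM; case: ifP => // _; rewrite nth_default//.
apply: leq_trans (size_polyMleq _ _) _; rewrite size_root_polyD.
apply: (@leq_trans (n + n * (expo p q e s).-1)).
  rewrite -subn1 leq_subLR add1n -addnS leq_add2l.
  by rewrite (leq_trans (size_poly_exp_leq _ _))// size_root_poly.
rewrite -mulnS prednK; last exact: expo_gt0.
rewrite n_def mulnDl mul1n -mulnA [(q * _)%N]mulnC.
rewrite (expoK p_gt1 e_order) -/(P s).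
have := expo_lt p_gt1 q_gt1 e_order s; rewrite -/(P s).
have := P_gt0 s; have := leq_mul (leqnn (P s)) gw; nia.
Qed.

Lemma sum_truncate (V : nmodType) (F : nat -> V) M : (g <= M)%N ->
  (forall i, (g <= i)%N -> F i = 0) -> \sum_(i < M) F i = \sum_(i < g) F i.
Proof.
move=> gM F0; rewrite -!(big_mkord xpredT F) (big_cat_nat (leq0n g) gM) /=.
rewrite [X in _ + X]big_nat_cond [X in _ + X]big1 ?addr0// => i /andP[/andP[gi
  _] _].
exact: F0.
Qed.

(** In [Phi_(s+1) = Phi_1 (F^N_s)^P] the second factor is, modulo [p], supported in degrees
    divisible by [P], with the [P]-th powers of the coefficients of [Phi_s] there. The convolution
    becomes a matrix product. *)
Lemma eqmodr_AmxS s z u v : (0 < s)%N ->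
  eqmodr p%:R (Amx p q e g s.+1 z u v)
    ((Amx p q e g 1 z *m map_mx (fun x => x ^+ (p ^ e)) (Amx p q e g s z)) u v).
Proof.
move=> s_gt0; rewrite -add1n -coef_Amx// PhiS mulrA.
have -> : (P (1 + s) * v.+1 = P 1 * (P s * v.+1))%N.
  by rewrite /P mulnDr expnD mulnA.
apply: eqmodr_trans (@eqmodr_coefM_multiples _ _ _ _ _ _ (P_gt0 1) _) _.
  move=> j ndj; rewrite /P muln1 in ndj *.
  (* [dvr_coef_exp] at [v = e - 1] yields exactly one factor [p]. *)
  have -> : p%:R = p%:R ^+ (e - e.-1) :> B by rewrite -subn1 subKn.
  by apply: dvr_coef_exp => //; rewrite prednK.
rewrite big_ord_recl coef_Amx_out// mul0r add0r.
under eq_bigr do rewrite lift0.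
rewrite (@sum_truncate _ (fun i => ('X^(u.+1) * Phi p q e 1 z)`_(P 1 * i.+1)
  * ((root_poly z ^+ N s) ^+ P 1)`_(P 1 * (P s * v.+1 - i.+1)))); first last.
- by move=> i gi; rewrite coef_Amx_out ?mul0r.
- by rewrite (leq_trans (ltnW (g_lt_P s_gt0)))// leq_pmulr.
rewrite mxE; apply: eqmodr_sum => w _; rewrite coef_Amx// !mxE.
apply: eqmodrM; first exact: eqmodr_refl.
by rewrite /P muln1 mulnC; apply: coef_exp_primeX.
Qed.

(** An existential form of being a unit, so that the restricted power series need no unit ring
    structure. *)
Definition invertible (x : B) := exists y, x * y = 1.

Hypothesis invertible_1Dp : forall b, invertible (1 + p%:R * b).

(** If [x = y + p b] and [y y' = 1], then [x = y (1 + p b y')]. *)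
Lemma invertible_eqmodr x y : eqmodr p%:R x y -> invertible y -> invertible x.
Proof.
move=> [b /eqP]; rewrite subr_eq => /eqP -> [y' yy'].
have [c] := invertible_1Dp (b * y'); exists (y' * c).
by rewrite mulrA mulrDl addrC yy' -mulrA.
Qed.

Lemma invertibleM x y : invertible x -> invertible y -> invertible (x * y).
Proof.
by move=> [x' xx'] [y' yy']; exists (x' * y'); rewrite mulrACA xx' yy' mulr1.
Qed.

Lemma invertibleX x k : invertible x -> invertible (x ^+ k).
Proof. by move=> [y xy]; exists (y ^+ k); rewrite -exprMn xy expr1n. Qed.

Lemma invertible_det_Amx s z : invertible (\det (Amx p q e g 1 z)) ->
  (0 < s)%N -> invertible (\det (Amx p q e g s z)).
Proof.
move=> inv1; elim: s => // -[//|s] IHs _.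
apply: invertible_eqmodr (eqmodr_det (fun u v => eqmodr_AmxS _ _ _ _)) _ => //.
rewrite det_mulmx; apply: invertibleM => //.
apply: invertible_eqmodr (eqmodr_det_exp _ _ pr_p odd_p) _.
exact/invertibleX/IHs.
Qed.

Lemma invertible_mx (A : 'M[B]_g) : invertible (\det A) ->
  exists L, A *m L = 1%:M.
Proof.
move=> [d dA]; exists (d *: \adj A).
by rewrite -scalemxAr mul_mx_adj scale_scalar_mx mulrC dA.
Qed.

Variables (z : 'rV[B]_n) (X : nat -> 'M[B]_(n, g)).
Hypothesis det_inv : forall s, (0 < s)%N -> invertible (\det (Amx p q e g s z)).
Hypothesis XE : forall s, (0 < s)%N ->
  X s *m Amx p q e g s z = Igen p q e g s z.

(** The [k]-th row of [I_s - X_i A_s] packed into one polynomial, with the entries at degrees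
    [P^s w], [0 < w <= g]. In this form it is [G i i k] times a [P^i]-th power. *)
Let G i s k := 'X * PhiD p q e s z k -
  \sum_(u < g) (X i k u)%:P * ('X^(u.+1) * Phi p q e s z).

Let coefG i s k r : (G i s k)`_r = ('X * PhiD p q e s z k)`_r -
  \sum_(u < g) X i k u * ('X^(u.+1) * Phi p q e s z)`_r.
Proof.
by rewrite coefB coef_sum; congr (_ - _); apply: eq_bigr => u _; rewrite coefCM.
Qed.

Let G_self i k w : (0 < i)%N -> (G i i k)`_(P i * w) = 0.
Proof.
move=> i_gt0; rewrite coefG; have [wout|] := boolP ((w == 0) || (g < w))%N.
  rewrite coef_Igen_out// big1 ?subr0// => u _.
  by rewrite coef_Amx_out ?mulr0.
rewrite negb_or -lt0n -leqNgt => /andP[w_gt0 wg].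
have wg' : (w.-1 < g)%N by rewrite prednK.
have -> : w = (Ordinal wg').+1 by rewrite /= prednK.
rewrite coef_Igen -XE// mxE; under eq_bigr do rewrite -coef_Amx//.
by rewrite subrr.
Qed.

(** The entries of [(X_s - X_i) A_s] are coefficients of [G i s k] at multiples of [P^s]; an inverse
    of [A_s] then frees [X_s - X_i]. *)
Let ratio_of_dvrG i s k u :
    (forall s k r, (i <= s)%N -> (P i %| r)%N -> dvr (p%:R ^+ i) (G i s k)`_r)
      ->
  (0 < i)%N -> (i <= s)%N -> eqmodr (p%:R ^+ i) (X s k u) (X i k u).
Proof.
move=> dvrG i_gt0 i_s; have s_gt0 : (0 < s)%N by exact: leq_trans i_s.
have [L AL] := invertible_mx (det_inv s_gt0).
suff dvrA (v : 'I_g) :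
    dvr (p%:R ^+ i) (((X s - X i) *m Amx p q e g s z) k v).
  rewrite /eqmodr; have -> : X s k u - X i k u =
      ((X s - X i) *m Amx p q e g s z *m L) k u.
    by rewrite -mulmxA AL mulmx1 !mxE.
  by rewrite mxE; apply: dvr_sum => v _; exact: dvr_mulr.
have -> : ((X s - X i) *m Amx p q e g s z) k v = (G i s k)`_(P s * v.+1).
  rewrite coefG coef_Igen -XE// mulmxBl [LHS]mxE; congr (_ + _).
  by rewrite [LHS]mxE mxE; congr (- _); apply: eq_bigr => w _; rewrite coef_Amx.
by apply: dvrG => //; rewrite dvdn_mulr// /P dvdn_exp2l// leq_mul2l i_s orbT.
Qed.

(* Write [Phi_s = Phi_i * f ^ (p ^ (e * i))] and expand the coefficient at [r].
   The coefficients of [G i i k] vanish at multiples of [p ^ (e * i)]. When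
   [p ^ (v + 1)] does not divide [j], with [v < e * i], the coefficient of the
   power at [j] is divisible by [p ^ (e * i - v)], and the one of [G i i k] at
   [r - j] by [p ^ (v / e)] by the induction hypothesis. *)
Let dvrG i : (0 < i)%N -> forall s k r, (i <= s)%N -> (P i %| r)%N ->
  dvr (p%:R ^+ i) (G i s k)`_r.
Proof.
elim/ltn_ind: i => i IHi i_gt0 s k r i_s Pr.
have -> : G i s k = G i i k * (root_poly z ^+ N (s - i)) ^+ P i.
  rewrite /G -[in LHS](subnKC i_s) PhiDS// PhiS mulrBl mulr_suml mulrA.
  by congr (_ - _); apply: eq_bigr => u _; rewrite !mulrA.
rewrite coefMr; apply: dvr_sum => j _.
have le_j : (j <= r)%N by rewrite -ltnS.
have [/dvdnP[w jE]|Pj] := boolP (P i %| j)%N.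
  have : (P i %| r - j)%N by rewrite dvdn_sub// jE dvdn_mull.
  by case/dvdnP => w' ->; rewrite mulnC G_self// mul0r; exact: dvr0.
have j_gt0 : (0 < j)%N by case: (val j) Pj => //; rewrite dvdn0.
pose v := logn p j.
have v_lt : (v < e * i)%N by rewrite ltnNge -pfactor_dvdn.
have dvr_pow : dvr (p%:R ^+ (e * i - v)) ((root_poly z ^+ N (s - i)) ^+ P i)`_j.
  by apply: dvr_coef_exp => //; rewrite pfactor_dvdn// -ltnNge.
pose i' := (v %/ e)%N.
have i'_lt : (i' < i)%N by rewrite ltn_divLR// mulnC.
have dvr_self : dvr (p%:R ^+ i') (G i i k)`_(r - j).
  have [->|i'_gt0] := posnP i'; first by rewrite expr0; exact: dvr1.
  have Pj' : (P i' %| r - j)%N.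
    rewrite dvdn_sub//.
      by apply: dvdn_trans Pr; rewrite /P dvdn_exp2l// leq_mul2l (ltnW i'_lt)
        orbT.
    by rewrite /P pfactor_dvdn// mulnC leq_trunc_div.
  (* The induction hypothesis concerns [G i' i k]. Passing to [G i i k] costs a combination of the
     [X i k u - X i' k u], which are divisible by [p^i'] too. *)
  have := IHi _ i'_lt i'_gt0 i k _ (ltnW i'_lt) Pj'.
  rewrite !coefG => dvrG'.
  have := @dvr_sum _ (p%:R ^+ i') _ (index_enum 'I_g) xpredT
    (fun u => (X i k u - X i' k u) * ('X^(u.+1) * Phi p q e i z)`_(r - j)).
  move=> /(_ _) /(dvrB dvrG'); rewrite -addrA -opprD -big_split /=.
  under eq_bigr do rewrite -mulrDl addrC subrK.
  apply=> u _; apply: dvr_mulr; apply: ratio_of_dvrG => //; last exact: ltnW.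
  exact: IHi.
have := dvrM dvr_self dvr_pow; rewrite -exprD; apply: dvr_exp_le.
exact: leq_divn_sub.
Qed.

Lemma eqmodr_ratio i s k u : (0 < i)%N -> (i <= s)%N ->
  eqmodr (p%:R ^+ i) (X s k u) (X i k u).
Proof. by move=> i_gt0; apply: ratio_of_dvrG => //; exact: dvrG. Qed.

End Hypergeometric.

(** * Nonarchimedean absolute values *)

Section AbsoluteValue.
Variables (R : realType) (K : fieldType) (abs : nonarch_absval R K).
Implicit Types (x y : K) (c d : R).

Lemma abs0 : abs 0 = 0.
Proof. by apply/eqP; rewrite absval_eq0. Qed.

Lemma abs_gt0 x : (0 < abs x) = (x != 0).
Proof. by rewrite lt0r absval_eq0 absval_ge0 andbT. Qed.

Lemma abs1 : abs 1 = 1.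
Proof.
have : abs 1 * abs 1 = abs 1 * 1 by rewrite -absvalM !mulr1.
by apply: mulfI; rewrite absval_eq0 oner_eq0.
Qed.

Lemma absX x k : abs (x ^+ k) = abs x ^+ k.
Proof. by elim: k => [|k IHk]; rewrite ?abs1// !exprS absvalM IHk. Qed.

Lemma absN x : abs (- x) = abs x.
Proof.
apply/eqP; rewrite -(@eqrXn2 _ 2)// ?absval_ge0//.
by rewrite -!absX sqrrN.
Qed.

Lemma absV x : abs x^-1 = (abs x)^-1.
Proof.
have [->|x0] := eqVneq x 0; first by rewrite invr0 abs0 invr0.
have ax0 : abs x != 0 by rewrite absval_eq0.
by apply: (mulfI ax0); rewrite -absvalM !divff// abs1.
Qed.

Lemma absB x y : abs (x - y) = abs (y - x).
Proof. by rewrite -absN opprB. Qed.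

Lemma abs_leD c x y : abs x <= c -> abs y <= c -> abs (x + y) <= c.
Proof.
by move=> xc yc; rewrite (le_trans (absvalD _ _ _))// ge_max xc yc.
Qed.

Lemma abs_leB c x y : abs x <= c -> abs y <= c -> abs (x - y) <= c.
Proof. by move=> xc yc; apply: abs_leD; rewrite ?absN. Qed.

Lemma abs_ltD c x y : abs x < c -> abs y < c -> abs (x + y) < c.
Proof.
by move=> xc yc; rewrite (le_lt_trans (absvalD _ _ _))// gt_max xc yc.
Qed.

Lemma abs_ltB c x y : abs x < c -> abs y < c -> abs (x - y) < c.
Proof. by move=> xc yc; apply: abs_ltD; rewrite ?absN. Qed.

Lemma abs_leM c d x y : abs x <= c -> abs y <= d -> abs (x * y) <= c * d.
Proof. by move=> xc yd; rewrite absvalM ler_pM// absval_ge0. Qed.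

Lemma abs_le_sum c (I : Type) (r : seq I) (Q : pred I) (f : I -> K) : 0 <= c ->
  (forall i, Q i -> abs (f i) <= c) -> abs (\sum_(i <- r | Q i) f i) <= c.
Proof.
by move=> c0 fc; elim/big_ind: _ => //; [rewrite abs0 | move=> *;
  exact: abs_leD].
Qed.

Lemma abs_nat k : abs k%:R <= 1.
Proof.
by elim: k => [|k IHk]; rewrite ?abs0 ?ler01// -addn1 natrD abs_leD// abs1.
Qed.

Lemma abs_lt_eq x y : abs (x - y) < abs y -> abs x = abs y.
Proof.
move=> xy; apply/eqP; rewrite eq_le; apply/andP; split.
  by rewrite -[x](subrK y) abs_leD// ltW.
rewrite leNgt; apply/negP => xlty; have := abs_ltB xlty xy.
by rewrite opprB addrC subrK ltxx.
Qed.

Definition integral_elt : pred K := [pred x | abs x <= 1].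

Lemma integral_elt_subring : subring_closed integral_elt.
Proof.
split; first by rewrite inE abs1.
- by move=> x y; rewrite !inE; exact: abs_leB.
- by move=> x y; rewrite !inE => /abs_leM xl /xl; rewrite mulr1.
Qed.

HB.instance Definition _ :=
  GRing.isSubringClosed.Build K integral_elt integral_elt_subring.

Lemma abs_cvg_unique (x : nat -> K) l l' :
  abs_cvg abs x l -> abs_cvg abs x l' -> l = l'.
Proof.
move=> xl xl'; apply/eqP; rewrite -subr_eq0; apply: contraT => ll'.
have e0 : 0 < abs (l - l') by rewrite abs_gt0.
have [N xlN] := xl _ e0; have [M xlM] := xl' _ e0.
have := abs_ltB (xlM _ (leq_maxr N M)) (xlN _ (leq_maxl N M)).
by rewrite opprB addrC addrA subrK ltxx.
Qed.

Lemma abs_limP (x : nat -> K) l : abs_cvg abs x l -> abs_lim abs x = l.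
Proof.
by move=> xl; apply: xget_unique => // l' xl'; exact: abs_cvg_unique xl' xl.
Qed.

Lemma abs_cvg_cst x : abs_cvg abs (fun=> x) x.
Proof. by move=> e e0; exists 0%N => k _; rewrite subrr abs0. Qed.

Lemma abs_cvgD (x y : nat -> K) l m :
  abs_cvg abs x l -> abs_cvg abs y m -> abs_cvg abs (fun k => x k + y k) (l +
    m).
Proof.
move=> xl ym e e0; have [N xN] := xl _ e0; have [M yM] := ym _ e0.
exists (maxn N M) => k; rewrite geq_max => /andP[Nk Mk].
by rewrite opprD addrACA abs_ltD ?xN ?yM.
Qed.

Lemma abs_cvgM (x y : nat -> K) l m :
  abs_cvg abs x l -> abs_cvg abs y m -> abs_cvg abs (fun k => x k * y k) (l *
    m).
Proof.
move=> xl ym e e0.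
pose c := 1 + abs l + abs m; have c0 : 0 < c.
  by rewrite /c -addrA ltr_pwDl// addr_ge0// absval_ge0.
have ec0 : 0 < Num.min 1 (e / c) by rewrite lt_min ltr01 divr_gt0.
have [N xN] := xl _ ec0; have [M yM] := ym _ ec0.
exists (maxn N M) => k; rewrite geq_max => /andP[/xN xk /yM yk].
have -> : x k * y k - l * m = (x k - l) * (y k - m) +
    ((x k - l) * m + l * (y k - m)).
  by rewrite !mulrBr !mulrBl; ring.
move: xk yk; rewrite !lt_min => /andP[xk1 xk] /andP[yk1 yk].
have small u v : abs u < e / c -> abs v <= c -> abs (u * v) < e.
  rewrite ltr_pdivlMr// absvalM => uc vc; apply: le_lt_trans uc.
  by rewrite ler_wpM2l ?absval_ge0.
have al := absval_ge0 abs l; have am := absval_ge0 abs m.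
apply: abs_ltD; last apply: abs_ltD.
- by apply: small => //; rewrite /c; lra.
- by apply: small => //; rewrite /c; lra.
- by rewrite mulrC; apply: small => //; rewrite /c; lra.
Qed.

Lemma abs_cvg_sum (I : Type) (r : seq I) (Q : pred I) (x : I -> nat -> K)
    (l : I -> K) : (forall i, Q i -> abs_cvg abs (x i) (l i)) ->
  abs_cvg abs (fun k => \sum_(i <- r | Q i) x i k) (\sum_(i <- r | Q i) l i).
Proof.
move=> xl; elim: r => [|i r IHr].
  by under eq_fun do rewrite big_nil; rewrite big_nil; exact: abs_cvg_cst.
under eq_fun do rewrite big_cons; rewrite big_cons.
by case: ifP => // Qi; apply: abs_cvgD => //; exact: xl.
Qed.

Lemma abs_cvg_le c (x : nat -> K) l N : abs_cvg abs x l ->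
  (forall k, (N <= k)%N -> abs (x k) <= c) -> abs l <= c.
Proof.
move=> xl xc; rewrite leNgt; apply/negP => cl.
have l0 : 0 < abs l.
  by apply: le_lt_trans cl; apply: le_trans (xc N _); rewrite ?absval_ge0.
have [M xM] := xl _ l0; have := xM _ (leq_maxr N M).
move=> /abs_lt_eq ale; have := xc _ (leq_maxl N M).
by rewrite ale leNgt cl.
Qed.

End AbsoluteValue.

Section NormOfP.
Variables (R : realType) (K : fieldType) (abs : nonarch_absval R K) (p : nat).
Hypotheses (pr_p : prime p) (abs_pE : abs p%:R = p%:R^-1).

Lemma abs_p_lt1 : abs p%:R < 1.
Proof. by rewrite abs_pE invf_lt1 ?ltr1n ?ltr0n ?prime_gt1 ?prime_gt0. Qed.

Lemma abs_p_gt0 : 0 < abs p%:R.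
Proof. by rewrite abs_pE invr_gt0 ltr0n prime_gt0. Qed.

Lemma natp_neq0 : p%:R != 0 :> K.
Proof. by rewrite -(abs_gt0 abs) abs_p_gt0. Qed.

Lemma abs_pX_small eps : 0 < eps ->
  exists N, forall k, (N <= k)%N -> abs p%:R ^+ k < eps.
Proof.
move=> eps0; exists (Num.bound eps^-1) => k Nk.
have lt_k : eps^-1 < k%:R.
  apply: lt_le_trans (archi_boundP _) _; first by rewrite invr_ge0 ltW.
  by rewrite ler_nat.
rewrite abs_pE exprVn -[eps]invrK ltf_pV2 ?posrE ?invr_gt0//.
  by rewrite (lt_trans lt_k)// -natrX ltr_nat ltn_expl ?prime_gt1.
by rewrite exprn_gt0// ltr0n prime_gt0.
Qed.

End NormOfP.

(** * Restricted power series *)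

Section Tate.
Variables (R : realType) (K : fieldType) (abs : nonarch_absval R K) (n p : nat).

Definition unit_polydisc := {w : 'rV[K]_n | `[< forall j, abs (w 0 j) <= 1 >]}.

HB.instance Definition _ := Choice.on unit_polydisc.

(** A base point, so that the functions on the polydisc form a ring with [1 != 0]. *)
Lemma unit_polydisc_subproof : `[< forall j, abs ((0 : 'rV[K]_n) 0 j) <= 1 >].
Proof. by apply/asboolP => j; rewrite mxE abs0. Qed.

HB.instance Definition _ :=
  isPointed.Build unit_polydisc (exist _ 0 unit_polydisc_subproof).

Lemma unit_polydiscP (w : unit_polydisc) j : abs (val w 0 j) <= 1.
Proof. by case: w => w /= /asboolP. Qed.

Definition gauss_le (c : R) (Q : {mpoly K[n]}) := forall m, abs Q@_m <= c.

Local Notation eval w Q := (meval (val w 0) Q).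

Lemma gauss_le_eval c Q (w : unit_polydisc) : 0 <= c -> gauss_le c Q ->
  abs (eval w Q) <= c.
Proof.
move=> c0 Qc; rewrite mevalE; apply: abs_le_sum => // m _.
rewrite -[c]mulr1; apply: abs_leM => //.
elim/big_ind: _ => [|x y x1 y1|j _]; first by rewrite abs1.
  by rewrite -[1]mulr1 abs_leM.
by rewrite absX exprn_ile1 ?absval_ge0 ?unit_polydiscP.
Qed.

Lemma gauss_leD c Q S : gauss_le c Q -> gauss_le c S -> gauss_le c (Q + S).
Proof. by move=> Qc Sc m; rewrite mcoeffD abs_leD. Qed.

Lemma gauss_leN c Q : gauss_le c Q -> gauss_le c (- Q).
Proof. by move=> Qc m; rewrite mcoeffN absN. Qed.

Lemma gauss_leM c d Q S : 0 <= c -> 0 <= d ->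
  gauss_le c Q -> gauss_le d S -> gauss_le (c * d) (Q * S).
Proof.
move=> c0 d0 Qc Sd m; rewrite mcoeffM abs_le_sum ?mulr_ge0// => k _.
exact: abs_leM.
Qed.

Lemma gauss_leC c x : abs x <= c -> gauss_le c x%:MP.
Proof.
move=> xc m; rewrite mcoeffC; case: eqP => _; rewrite ?mulr1// mulr0 abs0.
by rewrite (le_trans _ xc)// absval_ge0.
Qed.

Lemma gauss_leX m : gauss_le 1 'X_[m].
Proof. by move=> k; rewrite mcoeffX abs_nat. Qed.

Lemma gauss_leZ c d x Q : abs x <= c -> gauss_le d Q -> gauss_le (c * d) (x *:
  Q).
Proof. by move=> xc Qd m; rewrite mcoeffZ abs_leM. Qed.

Lemma gauss_le_sum c (I : Type) (r : seq I) (Q : I -> {mpoly K[n]}) : 0 <= c ->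
  (forall i, gauss_le c (Q i)) -> gauss_le c (\sum_(i <- r) Q i).
Proof.
move=> c0 Qc; elim/big_ind: _ => //; first by move=> m; rewrite mcoeff0 abs0.
by move=> *; exact: gauss_leD.
Qed.

Let vp := abs p%:R.

(* The ring [O<w_1, ..., w_n>] of restricted power series, seen as functions on
   the points of the unit polydisc over [K]. The approximations [Q N] have to be
   congruent to each other as polynomials: the residue field is finite, so that
   uniform limits of polynomials on these points need not be analytic. *)
Definition tate (f : unit_polydisc -> K) := exists Q : nat -> {mpoly K[n]},
  [/\ forall N, gauss_le 1 (Q N), forall N, gauss_le (vp ^+ N) (Q N.+1 - Q N) &
    forall N w, abs (f w - eval w (Q N)) <= vp ^+ N].

Let vp_ge0 : 0 <= vp. Proof. exact: absval_ge0. Qed.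

Let vpX_ge0 N : 0 <= vp ^+ N. Proof. exact: exprn_ge0. Qed.

Lemma tate_le1 f w : tate f -> abs (f w) <= 1.
Proof.
move=> [Q [Q1 _ /(_ 0%N w) fQ]]; rewrite expr0 in fQ.
by rewrite -[f w](subrK (eval w (Q 0%N))) abs_leD// gauss_le_eval.
Qed.

Lemma tateB f h : tate f -> tate h -> tate (f - h).
Proof.
move=> [Q [Q1 dQ fQ]] [S [S1 dS hS]]; exists (fun N => Q N - S N); split=> N.
- exact/gauss_leD/gauss_leN.
- have -> : Q N.+1 - S N.+1 - (Q N - S N) = Q N.+1 - Q N - (S N.+1 - S N) by
  ring.
  exact/gauss_leD/gauss_leN.
- move=> w; rewrite mevalB.
  have -> : (f - h) w - (eval w (Q N) - eval w (S N)) =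
    (f w - eval w (Q N)) - (h w - eval w (S N)).
    by rewrite -[(f - h) w]/(f w - h w); ring.
  exact: abs_leB.
Qed.

Lemma tateM f h : tate f -> tate h -> tate (f * h).
Proof.
move=> [Q [Q1 dQ fQ]] [S [S1 dS hS]]; exists (fun N => Q N * S N); split=> N.
- by rewrite -[1]mulr1; apply: gauss_leM.
- have -> : Q N.+1 * S N.+1 - Q N * S N =
    Q N.+1 * (S N.+1 - S N) + (Q N.+1 - Q N) * S N by ring.
  apply: gauss_leD; first by rewrite -[vp ^+ N]mul1r; apply: gauss_leM.
  by rewrite -[vp ^+ N]mulr1; apply: gauss_leM.
- move=> w; rewrite mevalM.
  have -> : (f * h) w - eval w (Q N) * eval w (S N) =
    f w * (h w - eval w (S N)) + (f w - eval w (Q N)) * eval w (S N).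
    by rewrite -[(f * h) w]/(f w * h w); ring.
  apply: abs_leD; rewrite -[vp ^+ N]mulr1; last first.
    by apply: abs_leM => //; exact: gauss_le_eval.
  by rewrite mulrC abs_leM// tate_le1//; exists Q.
Qed.

Lemma tate_mpoly Q : gauss_le 1 Q -> tate (fun w => eval w Q).
Proof.
move=> Q1; exists (fun=> Q); split=> // N.
  by rewrite subrr => m; rewrite mcoeff0 abs0.
by move=> w; rewrite subrr abs0.
Qed.

Lemma tate_cst x : abs x <= 1 -> tate (cst x).
Proof.
move=> x1; have := tate_mpoly (gauss_leC x1).
by congr tate; apply/funext => w; rewrite mevalC.
Qed.

Lemma tate_coord j : tate (fun w => val w 0 j).
Proof.
have := tate_mpoly (@gauss_leX U_(j)%MM).
by congr tate; apply/funext => w; rewrite mevalXU.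
Qed.

(** The steps must be [p^k] times members of the ring, not merely small in value: only then are the
    diagonal approximations [Q N + \sum_(k < N) p^k S k N] congruent coefficient by coefficient. *)
Lemma tate_limit (f h : nat -> unit_polydisc -> K) l :
    tate (f 0%N) -> (forall k, tate (h k)) ->
    (forall k w, f k.+1 w - f k w = p%:R ^+ k * h k w) ->
    (forall k w, abs (l w - f k w) <= vp ^+ k) ->
  tate l.
Proof.
move=> [Q [Q1 dQ fQ]] /choice[S hS] df lf.
have S1 k N : gauss_le 1 (S k N) by case: (hS k).
have pk k : abs (p%:R ^+ k) <= vp ^+ k by rewrite absX.
have vp1 k : vp ^+ k <= 1 by rewrite exprn_ile1// abs_nat.
exists (fun N => Q N + \sum_(k < N) p%:R ^+ k *: S k N); split=> N.
- apply: gauss_leD => //; apply: gauss_le_sum => // k.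
  by rewrite -[1]mulr1; apply: gauss_leZ => //; rewrite (le_trans (pk _)).
- rewrite big_ord_recr /= opprD addrACA [X in _ + X]addrAC.
  apply: gauss_leD => //; apply: gauss_leD; last first.
    by rewrite -[vp ^+ N]mulr1; apply: gauss_leZ.
  rewrite -sumrB; apply: gauss_le_sum => // k.
  rewrite -scalerBr -[vp ^+ N]mul1r; apply: gauss_leZ.
    by rewrite (le_trans (pk _)).
  by case: (hS k).
- move=> w; have fE : f N w = f 0%N w + \sum_(k < N) p%:R ^+ k * h k w.
    elim: N => [|N IHN]; first by rewrite big_ord0 addr0.
    by rewrite big_ord_recr /= addrA -IHN -df addrC subrK.
  rewrite -[l w](subrK (f N w)) -addrA abs_leD// fE.
  rewrite mevalD raddf_sum /= opprD addrACA abs_leD// -sumrB abs_le_sum// => k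
    _.
  rewrite mevalZ -mulrBr -[vp ^+ N]mul1r abs_leM// ?(le_trans (pk _))//.
  by case: (hS k).
Qed.

Definition tate_pred : pred (unit_polydisc -> K) := [pred f | `[< tate f >]].

Lemma tate_subring : subring_closed tate_pred.
Proof.
split; first by apply/asboolP/tate_cst; rewrite abs1.
- by move=> f h /asboolP tf /asboolP th; apply/asboolP/tateB.
- by move=> f h /asboolP tf /asboolP th; apply/asboolP/tateM.
Qed.

HB.instance Definition _ :=
  GRing.isSubringClosed.Build (unit_polydisc -> K) tate_pred tate_subring.

Record tate_ring := TateRing {
  tate_val :> unit_polydisc -> K; _ : tate_val \in tate_pred }.

HB.instance Definition _ := [isSub for tate_val].
HB.instance Definition _ := [Choice of tate_ring by <:].
HB.instance Definition _ := [SubChoice_isSubComNzRing of tate_ring by <:].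

Lemma tate_ringP (f : tate_ring) : tate f.
Proof. by case: f => f /= /asboolP. Qed.

Lemma tate_ringI (f h : tate_ring) : f =1 h -> f = h.
Proof. by move=> fh; apply: val_inj; apply/funext. Qed.

Definition to_tate f (tf : tate f) : tate_ring := TateRing (asboolT tf).

Definition tate_eval (w : unit_polydisc) (f : tate_ring) : K := f w.

Lemma tate_eval_additive w : additive (tate_eval w).
Proof. by []. Qed.

Lemma tate_eval_multiplicative w : multiplicative (tate_eval w).
Proof. by []. Qed.

HB.instance Definition _ w :=
  GRing.isAdditive.Build tate_ring K (tate_eval w) (tate_eval_additive w).
HB.instance Definition _ w := GRing.isMultiplicative.Build tate_ring K
  (tate_eval w) (tate_eval_multiplicative w).

Hypotheses (vp_lt1 : vp < 1) (p_neq0 : p%:R != 0 :> K).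

Lemma tate_preg (f : tate_ring) : p%:R * f = 0 -> f = 0.
Proof.
move=> pf; apply: tate_ringI => w.
have /eqP : tate_eval w (p%:R * f) = 0 by rewrite pf rmorph0.
by rewrite rmorphM rmorph_nat mulf_eq0 (negPf p_neq0) => /eqP.
Qed.

(** The inverse is a geometric series with terms [p^k (-b)^k], to which [tate_limit] applies. *)
Lemma tate_invertible_1Dp (b : tate_ring) : invertible (1 + p%:R * b).
Proof.
have unit_val w : abs (1 + p%:R * b w) = 1.
  have pb : abs (p%:R * b w) < 1.
    rewrite absvalM (le_lt_trans _ vp_lt1)// ler_piMr//.
    apply/tate_le1/tate_ringP.
  by rewrite (@abs_lt_eq _ _ _ _ 1) ?abs1// addrAC subrr add0r.
have nz w : 1 + p%:R * b w != 0 by rewrite -(absval_eq0 abs) unit_val oner_eq0.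
pose f k w := \sum_(j < k) (- (p%:R * b w)) ^+ j.
pose h k w := (- b w) ^+ k.
have fE k w : f k w * (1 + p%:R * b w) = 1 - (- (p%:R * b w)) ^+ k.
  rewrite -[in X in _ * X](opprK (p%:R * b w)) mulrC.
  by rewrite -[LHS]opprK -mulNr opprB -subrX1 opprB.
have tinv : tate (fun w => (1 + p%:R * b w)^-1).
  apply: (@tate_limit f h).
  - suff -> : f 0%N = cst 0 by apply: tate_cst; rewrite abs0 ler01.
    by apply/funext => w; rewrite /f big_ord0.
  - move=> k; have := tate_ringP ((- b) ^+ k).
    by congr tate; apply/funext => w; rewrite -[LHS]/(tate_eval w _) rmorphXn
      rmorphN.
  - move=> k w; rewrite /f big_ord_recr /= [_ + _ ^+ _]addrC addrK.
    by rewrite -mulrN exprMn.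
  - move=> k w.
    have -> : (1 + p%:R * b w)^-1 - f k w = (- (p%:R * b w)) ^+ k / (1 + p%:R
      * b w).
      apply: (mulIf (nz w)); rewrite mulrBl mulVf// divfK//.
      by rewrite fE opprB addrC subrK.
    rewrite absvalM absV unit_val invr1 mulr1 absX absN absvalM exprMn.
    rewrite ler_piMr// exprn_ile1 ?absval_ge0//.
    apply/tate_le1/tate_ringP.
exists (to_tate tinv); apply: tate_ringI => w.
rewrite -[LHS]/(tate_eval w _) rmorphM rmorphD rmorphM rmorph1 rmorph_nat.
exact: (divff (nz w)).
Qed.

End Tate.

(** * The limit matrix *)

Section Limit.
Variables (R : realType) (K : fieldType) (abs : nonarch_absval R K).
Variables (p q e g n : nat).
Hypotheses (pr_p : prime p) (odd_p : odd p) (q_gt1 : (1 < q)%N).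
Hypotheses (e_gt0 : (0 < e)%N) (e_order : p ^ e = 1 %[mod q]).
Hypotheses (n_def : n = (g * q + 1)%N) (n_lt_pe : (n < p ^ e)%N).
Hypothesis abs_pE : abs p%:R = p%:R^-1.
Hypothesis complete : forall x : nat -> K, abs_cauchy abs x ->
  exists l, abs_cvg abs x l.

Let p_lt1 : abs p%:R < 1 := abs_p_lt1 pr_p abs_pE.

Let p_neq0 : p%:R != 0 :> K := natp_neq0 pr_p abs_pE.

Local Notation vp := (abs p%:R).
Local Notation T := (tate_ring abs n p).

Let p_gt1 : (1 < p)%N := prime_gt1 pr_p.

Lemma Imx_Igen s (z : 'rV[K]_n) : (0 < s)%N ->
  Imx p q e g s z = Igen p q e g s z :> _.
Proof.
move=> s_gt0; apply/matrixP => k l; rewrite !mxE.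
by rewrite -(PhiDE pr_p e_gt0 e_order z k s_gt0) mulKp ?polyXsubC_eq0.
Qed.

Definition Iratio s (z : 'rV[K]_n) : 'M[K]_(n, g) :=
  Imx p q e g s z *m invmx (Amx p q e g s z).

Section Polydisc.
Variables (u : 'rV[K]_n) (pi : K).
Hypotheses (u_D : D_KZ p q e g abs u) (pi_le : abs pi <= vp).

Definition polydisc_pt (w : unit_polydisc abs n) := u + pi *: val w.

Let u_le j : abs (u 0 j) <= 1. Proof. by case: u_D. Qed.

Let tate_pt j : tate p (fun w => polydisc_pt w 0 j).
Proof.
have tu : tate p (cst (u 0 j) : unit_polydisc abs n -> K) by exact: tate_cst.
have tpi : tate p (cst (- pi) : unit_polydisc abs n -> K).
  by apply: tate_cst; rewrite absN (le_trans pi_le)// abs_nat.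
have := tateB tu (tateM tpi (tate_coord abs p j)).
congr tate; apply/funext => w; rewrite !mxE.
by rewrite -[LHS]/(u 0 j - (- pi * val w 0 j)) mulNr opprK.
Qed.

(** The universal point of the polydisc: identities and congruences over [T] at [z] specialise to
    every point by evaluation. *)
Let z : 'rV[T]_n := \row_j to_tate (tate_pt j).

Let z_eval w : map_mx (tate_eval w) z = polydisc_pt w.
Proof. by apply/rowP => j; rewrite [LHS]mxE mxE. Qed.

Let c : 'rV[T]_n := \row_j to_tate (tate_cst n p (u_le j)).

Let c_eval w : map_mx (tate_eval w) c = u.
Proof. by apply/rowP => j; rewrite [LHS]mxE mxE. Qed.

Let det_c : invertible (\det (Amx p q e g 1 c)).
Proof.
have /tate_cst tinv : abs (\det (Amx p q e g 1 u))^-1 <= 1.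
  by rewrite absV; case: u_D => _ ->; rewrite invr1.
exists (to_tate (tinv n p)); apply: tate_ringI => w.
rewrite -[LHS]/(tate_eval w _) rmorphM /= -det_map_mx map_Amx c_eval.
rewrite /tate_eval /= divff//.
by rewrite -(absval_eq0 abs); case: u_D => _ ->; rewrite oner_eq0.
Qed.

(** The bound on [pi] enters here: [pi / p] is integral, so the universal point is congruent to the
    centre modulo [p] and [det A_1] remains invertible. *)
Let eqm_zc j : eqmodr p%:R (z 0 j) (c 0 j).
Proof.
have /tate_cst tpi : abs (pi / p%:R) <= 1.
  by rewrite absvalM absV ler_pdivrMr ?mul1r// abs_gt0.
exists (to_tate (tpi n p) * to_tate (tate_coord abs p j)).
apply: tate_ringI => w; rewrite -[LHS]/(tate_eval w _) -[RHS]/(tate_eval w _).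
rewrite rmorphB !rmorphM rmorph_nat !mxE /tate_eval /= !mxE.
rewrite /cst -[sval w]/(val w) [u 0 j + _]addrC addrK mulrA.
by rewrite [p%:R * _]mulrC divfK.
Qed.

Let det_z s : (0 < s)%N -> invertible (\det (Amx p q e g s z)).
Proof.
have inv1 : invertible (\det (Amx p q e g 1 z)).
  apply: (invertible_eqmodr (tate_invertible_1Dp p_lt1) _ det_c).
  by apply: eqmodr_det => i j; exact: eqmodr_Amx.
exact: (invertible_det_Amx pr_p odd_p q_gt1 e_gt0 e_order n_def n_lt_pe
  (tate_preg p_neq0) (tate_invertible_1Dp p_lt1) inv1).
Qed.

Lemma ratio_polydisc : exists X : nat -> 'M[T]_(n, g),
  (forall s w, (0 < s)%N ->
     abs (\det (Amx p q e g s (polydisc_pt w))) = 1 /\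
     Iratio s (polydisc_pt w) = map_mx (tate_eval w) (X s)) /\
  (forall i s k v, (0 < i)%N -> (i <= s)%N ->
     eqmodr (p%:R ^+ i) (X s k v) (X i k v)).
Proof.
have /choice[X XE] s : exists X, (0 < s)%N ->
    X *m Amx p q e g s z = Igen p q e g s z.
  have [->|s_gt0] := posnP s; first by exists 0.
  have [L AL] := invertible_mx (det_z s_gt0).
  by exists (Igen p q e g s z *m L) => _; rewrite -mulmxA (mulmx1C AL) mulmx1.
exists X; split=> [s w s_gt0|i s k v i_gt0 i_s]; last first.
  exact: (eqmodr_ratio pr_p odd_p q_gt1 e_gt0 e_order n_def n_lt_pe (tate_preg
    p_neq0) det_z XE).
have det_eval : tate_eval w (\det (Amx p q e g s z)) =
    \det (Amx p q e g s (polydisc_pt w)).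
  by rewrite -det_map_mx map_Amx z_eval.
have [d dE] := det_z s_gt0.
have dE' : \det (Amx p q e g s (polydisc_pt w)) * tate_eval w d = 1.
  by rewrite -det_eval -rmorphM dE rmorph1.
split.
  (* The determinant and its inverse are both integral, so the absolute value is 1. *)
  apply/eqP; rewrite eq_le -det_eval; apply/andP; split.
    exact/tate_le1/tate_ringP.
  rewrite -(abs1 abs) -dE' -det_eval absvalM ler_piMr ?absval_ge0//.
  exact/tate_le1/tate_ringP.
rewrite /Iratio Imx_Igen// -z_eval -map_Amx -map_Igen -XE// map_mxM.
rewrite mulmxK// unitmxE map_Amx z_eval unitfE.
by apply/eqP => d0; move/eqP: dE'; rewrite d0 mul0r eq_sym oner_eq0.
Qed.

End Polydisc.

Lemma limit_of_steps (x : nat -> K) :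
    (forall i s, (0 < i)%N -> (i <= s)%N -> abs (x s - x i) <= vp ^+ i) ->
  exists2 l, abs_cvg abs x l & forall i, (0 < i)%N -> abs (l - x i) <= vp ^+ i.
Proof.
move=> dx; have /complete[l xl] : abs_cauchy abs x.
  move=> eps /(abs_pX_small pr_p abs_pE)[N ltN]; exists N.+1 => k l Nk Nl.
  have xN m : (N.+1 <= m)%N -> abs (x m - x N.+1) < eps.
    by move=> Nm; rewrite (le_lt_trans (dx _ _ _ _))// ltN.
  rewrite -[x k](subrK (x N.+1)) -addrA abs_ltD ?xN// absB xN//.
exists l => // i i_gt0.
have dcvg := abs_cvgD xl (abs_cvg_cst abs (- x i)).
by apply: (@abs_cvg_le _ _ _ _ _ _ i dcvg) => k ik; exact: dx.
Qed.

Lemma ratio_dist (a : 'rV[K]_n) : D_KZ p q e g abs a ->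
  [/\ forall s, (0 < s)%N -> abs (\det (Amx p q e g s a)) = 1,
      forall s k v, (0 < s)%N -> abs (Iratio s a k v) <= 1,
      forall k v, abs_cvg abs (fun s => Iratio s a k v) (Ilim p q e g abs a k
        v),
      forall s k v, (0 < s)%N ->
        abs (Ilim p q e g abs a k v - Iratio s a k v) <= vp ^+ s &
      forall k v, abs (Ilim p q e g abs a k v) <= 1].
Proof.
(* The degenerate polydisc [pi = 0] consists of [a] alone. *)
move=> aD; have pi_le : abs 0 <= vp by rewrite abs0 absval_ge0.
have [X [Xratio Xstep]] := ratio_polydisc aD pi_le.
have ptE : polydisc_pt a 0 point = a by rewrite /polydisc_pt scale0r addr0.
have XratioE s : (0 < s)%N -> Iratio s a = map_mx (tate_eval point) (X s).
  by move=> s_gt0; have [_] := Xratio s point s_gt0; rewrite ptE.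
have ratio_le s k v : (0 < s)%N -> abs (Iratio s a k v) <= 1.
  by move=> s_gt0; rewrite XratioE// mxE; apply/tate_le1/tate_ringP.
have step k v i s : (0 < i)%N -> (i <= s)%N ->
    abs (Iratio s a k v - Iratio i a k v) <= vp ^+ i.
  move=> i_gt0 i_s; rewrite !XratioE ?(leq_trans i_gt0)// !mxE -rmorphB.
  have [b ->] := Xstep i s k v i_gt0 i_s.
  rewrite rmorphM rmorphXn rmorph_nat absvalM absX ler_piMr ?exprn_ge0
    ?absval_ge0//.
  by apply/tate_le1/tate_ringP.
have lim k v : abs_cvg abs (fun s => Iratio s a k v) (Ilim p q e g abs a k v) /\
    forall s, (0 < s)%N -> abs (Ilim p q e g abs a k v - Iratio s a k v) <= vp
      ^+ s.
  have [l xl dl] := limit_of_steps (step k v).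
  by rewrite mxE (abs_limP xl).
split=> //.
- by move=> s /(Xratio s point)[]; rewrite ptE.
- by move=> k v; case: (lim k v).
- by move=> s k v; case: (lim k v) => _; apply.
- move=> k v; have [_ /(_ 1%N isT)] := lim k v; rewrite expr1 => le_p.
  rewrite -[Ilim _ _ _ _ _ _ _ _](subrK (Iratio 1 a k v)).
  by rewrite abs_leD// ?ratio_le// (le_trans le_p)// ltW.
Qed.

Lemma polydisc_D u pi w : D_KZ p q e g abs u -> abs pi <= vp ->
  D_KZ p q e g abs (polydisc_pt u pi w).
Proof.
move=> uD pi_le; split; last first.
  by have [X [/(_ 1%N w isT)[]]] := ratio_polydisc uD pi_le.
move=> j; rewrite !mxE abs_leD//; first by case: uD.
rewrite -[X in _ <= X]mulr1; apply: abs_leM; last exact: unit_polydiscP.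
by rewrite (le_trans pi_le)// ltW.
Qed.

Lemma tate_Ilim u pi k v : D_KZ p q e g abs u -> abs pi <= vp ->
  tate p (fun w => Ilim p q e g abs (polydisc_pt u pi w) k v).
Proof.
move=> uD pi_le; have [X [Xratio Xstep]] := ratio_polydisc uD pi_le.
have /choice[b bE] s : exists b : T, X s.+2 k v - X s.+1 k v = p%:R ^+ s.+1 * b.
  exact: Xstep.
(* The sequence starts at [X 1], as [X 0] is uncontrolled; the surplus factor [p] of each step is
   put into [p b_s]. *)
apply: (@tate_limit _ _ _ _ _ (fun s => X s.+1 k v) (fun s => p%:R * b s)).
- exact: tate_ringP.
- by move=> s; exact: tate_ringP.
- move=> s w; rewrite -[LHS]/(tate_eval w (X s.+2 k v - X s.+1 k v)) bE.
  by rewrite exprSr -mulrA rmorphM rmorphXn rmorph_nat.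
- move=> s w; have [_ _ _ dl _] := ratio_dist (polydisc_D w uD pi_le).
  have -> : X s.+1 k v w = Iratio s.+1 (polydisc_pt u pi w) k v.
    by have [_ ->] := Xratio s.+1 w isT; rewrite mxE.
  by rewrite (le_trans (dl _ _ _ _))// exprS ler_piMl ?exprn_ge0 ?absval_ge0//
    ltW.
Qed.

End Limit.

(** * Derivative of the limit matrix *)

Lemma polyOver_root_poly n (K : fieldType) (S : subringClosed K) (a :
  'rV[K]_n) Q :
    (forall j, a 0 j \in S) ->
  \prod_(i < n | Q i) ('X - (a 0 i)%:P) \is a polyOver S.
Proof.
by move=> Sa; apply: rpred_prod => i _; rewrite rpredB ?polyOverX ?polyOverC.
Qed.

(** Taylor expansion with remainder over [S]. For [S] the ring of integers the remainder is bounded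
    by 1, whatever [N] is. *)
Lemma exp_shift (K : fieldType) (S : subringClosed K) (x : {poly K}) h N :
    x \is a polyOver S -> h \in S -> exists2 E, E \is a polyOver S &
  (x - h%:P) ^+ N = x ^+ N - (h *+ N) *: x ^+ N.-1 + h ^+ 2 *: E.
Proof.
move=> Sx Sh; elim: N => [|N [E SE IHN]].
  by exists 0; rewrite ?rpred0// !expr0 mulr0n scale0r scaler0 subr0 addr0.
exists (x ^+ N.-1 *+ N + (x - h%:P) * E).
  by rewrite rpredD ?rpredMn ?rpredX// rpredM// rpredB// polyOverC.
rewrite exprS IHN /=; case: N {IHN} => [|N] /=.
  by rewrite !expr0 expr1 mulr1n -!mul_polyC; ring.
have hN k : (h *+ k)%:P = h%:P * k%:R by rewrite polyCMn mulr_natr.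
rewrite -!mul_polyC !hN [in N.+2%:R]mulrS -(mulr_natl (x ^+ N)) polyC_exp.
by rewrite !exprS; move: (x ^+ N) (N.+1%:R) => y k; ring.
Qed.

(** * Expansion of [Phi_s] and its quotients under a shift of one [z_i] *)

Section Shift.
Variables (p q e n s : nat) (K : fieldType) (S : subringClosed K).
Variables (a : 'rV[K]_n) (i : 'I_n) (h : K).
Hypotheses (Sa : forall j, a 0 j \in S) (Sh : h \in S).

Let a' := a + h *: delta_mx 0 i.

Let N := expo p q e s.

Let a'_i : a' 0 i = a 0 i + h.
Proof. by rewrite !mxE !eqxx mulr1. Qed.

Let a'_neq j : j != i -> a' 0 j = a 0 j.
Proof. by rewrite !mxE => /negPf ->; rewrite mulr0 addr0. Qed.

Let SX j : 'X - (a 0 j)%:P \is a polyOver S.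
Proof. by rewrite rpredB ?polyOverX ?polyOverC. Qed.

Let exp_shiftX : exists2 E, E \is a polyOver S &
  ('X - (a' 0 i)%:P) ^+ N =
  ('X - (a 0 i)%:P) ^+ N - (h *+ N) *: ('X - (a 0 i)%:P) ^+ N.-1 + h ^+ 2 *: E.
Proof.
have [E SE EE] := exp_shift N (SX i) Sh.
by exists E; rewrite // a'_i polyCD opprD addrA.
Qed.

Let root_polyD_shift : root_polyD a' i = root_polyD a i.
Proof. by apply: eq_bigr => j /a'_neq ->. Qed.

Lemma Phi_shift : exists2 E, E \is a polyOver S &
  Phi p q e s a' = Phi p q e s a - (h *+ N) *: PhiD p q e s a i + h ^+ 2 *: E.
Proof.
have [E SE EE] := exp_shiftX; exists (E * root_polyD a i ^+ N).
  by rewrite rpredM ?rpredX//; exact: polyOver_root_poly.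
rewrite /Phi -/(root_poly _) -/(root_poly _) -/(expo p q e s) -/N.
rewrite -!(root_polyDE _ i) exprMn EE root_polyD_shift /PhiD -(root_polyDE _ i).
rewrite !exprMn -/N -!mul_polyC.
have [->|/prednK NE] := posnP N; first by rewrite !expr0 mulr0n polyC0; ring.
have -> : root_polyD a i ^+ N = root_polyD a i * root_polyD a i ^+ N.-1.
  by rewrite -exprS NE.
by ring.
Qed.

(* [PhiDD k] is [Phi / (('X - a_i) * ('X - a_k))] for [k != i] and [0 < N]. *)
Definition root_polyDD k := \prod_(j < n | (j != k) && (j != i)) ('X - (a 0
  j)%:P).

Definition PhiDD k :=
  root_polyDD k * root_polyD a i ^+ N.-1 * ('X - (a 0 i)%:P) ^+ N.-1.

Let root_polyDDE (z : 'rV[K]_n) k : k != i -> root_polyD z k = ('X - (z 0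
  i)%:P) *
  \prod_(j < n | (j != k) && (j != i)) ('X - (z 0 j)%:P).
Proof. by move=> ki; rewrite /root_polyD (bigD1 i) 1?eq_sym. Qed.

Let root_polyDDEi k : k != i -> root_polyD a i = ('X - (a 0 k)%:P) *
  root_polyDD k.
Proof.
move=> ki; rewrite /root_polyD (bigD1 k)//; congr (_ * _).
by apply: eq_bigl => j; rewrite andbC.
Qed.

Lemma polyOver_PhiDD k : PhiDD k \is a polyOver S.
Proof. by rewrite !(rpredM, rpredX)//; exact: polyOver_root_poly. Qed.

(** Partial fractions: the source of the denominators [z_i - z_k] of the KZ operator, while [PhiDD]
    itself is integral. *)
Lemma PhiDDE k : k != i -> (0 < N)%N ->
  (a 0 k - a 0 i) *: PhiDD k = PhiD p q e s a k - PhiD p q e s a i.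
Proof.
move=> ki N_gt0; rewrite /PhiDD /PhiD -/N -!(root_polyDE _ i) !exprMn.
rewrite (root_polyDDE a ki) -/(root_polyDD k) -mul_polyC polyCB.
by rewrite [X in _ = _ - X * _](root_polyDDEi ki); ring.
Qed.

Lemma PhiD_shift k : k != i -> (0 < N)%N -> exists2 E, E \is a polyOver S &
  PhiD p q e s a' k = PhiD p q e s a k - (h *+ N) *: PhiDD k + h ^+ 2 *: E.
Proof.
move=> ki N_gt0; have [E SE EE] := exp_shiftX.
have SDD : root_polyDD k \is a polyOver S by exact: polyOver_root_poly.
exists (root_polyDD k * root_polyD a i ^+ N.-1 * E).
  by rewrite !(rpredM, rpredX)//; exact: polyOver_root_poly.
have PhiDE' (z : 'rV[K]_n) : PhiD p q e s z k =
    \prod_(j < n | (j != k) && (j != i)) ('X - (z 0 j)%:P) *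
    root_polyD z i ^+ N.-1 * ('X - (z 0 i)%:P) ^+ N.
  rewrite /PhiD -/N (root_polyDDE z ki) -(root_polyDE _ i) exprMn.
  have -> : ('X - (z 0 i)%:P) ^+ N = ('X - (z 0 i)%:P) * ('X - (z 0 i)%:P) ^+
    N.-1.
    by rewrite -exprS prednK.
  by ring.
rewrite !PhiDE' root_polyD_shift EE -/(root_polyDD k).
have -> : \prod_(j < n | (j != k) && (j != i)) ('X - (a' 0 j)%:P) =
  root_polyDD k.
  by apply: eq_bigr => j /andP[_ /a'_neq ->].
by rewrite /PhiDD -!mul_polyC; ring.
Qed.

End Shift.

(** The relation [(t - a_i) PhiD = Phi] is a recurrence, solved here downwards from degree [r - 1].
    The powers of [a_i] become the entries of [conn_mx]. *)
Lemma coef_PhiD_down p q e n s (K : fieldType) (a : 'rV[K]_n) i r u :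
    ('X - (a 0 i)%:P) * PhiD p q e s a i = Phi p q e s a -> (u < r)%N ->
  (PhiD p q e s a i)`_(r - u.+1) = a 0 i ^+ u * (PhiD p q e s a i)`_(r - 1) +
    \sum_(b < u) a 0 i ^+ (u - b.+1) * (Phi p q e s a)`_(r - b.+1).
Proof.
move=> PhiE; elim: u => [|u IHu] ur; first by rewrite big_ord0 addr0 mul1r.
have step : (Phi p q e s a)`_(r - u.+1) =
    (PhiD p q e s a i)`_(r - u.+2) - a 0 i * (PhiD p q e s a i)`_(r - u.+1).
  rewrite -PhiE mulrBl coefB coefXM coefCM subn_eq0 leqNgt ur /=.
  by rewrite -subn1 -subnDA addn1.
have -> : (PhiD p q e s a i)`_(r - u.+2) =
    (Phi p q e s a)`_(r - u.+1) + a 0 i * (PhiD p q e s a i)`_(r - u.+1).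
  by rewrite step subrK.
rewrite (IHu (ltnW ur)) big_ord_recr /= subnn expr0 mul1r exprS mulrDr mulrA.
rewrite addrCA; congr (_ + _); rewrite addrC mulr_sumr; congr (_ + _).
by apply: eq_bigr => b _; rewrite mulrA -exprS subSn.
Qed.

Section IntegralMatrices.
Variables (R : realType) (K : fieldType) (abs : nonarch_absval R K).

Definition mxint m k (M : 'M[K]_(m, k)) := forall i j, abs (M i j) <= 1.

Lemma mxintB m k (M L : 'M_(m, k)) : mxint M -> mxint L -> mxint (M - L).
Proof. by move=> M1 L1 i j; rewrite !mxE abs_leB. Qed.

Lemma mxintZ m k x (M : 'M_(m, k)) : abs x <= 1 -> mxint M -> mxint (x *: M).
Proof. by move=> x1 M1 i j; rewrite mxE -[1]mulr1 abs_leM. Qed.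

Lemma mxintM m k l (M : 'M_(m, k)) (L : 'M_(k, l)) :
  mxint M -> mxint L -> mxint (M *m L).
Proof.
move=> M1 L1 i j; rewrite mxE abs_le_sum// => t _.
by rewrite -[1]mulr1 abs_leM.
Qed.

Lemma mxint_inv k (M : 'M_k) : mxint M -> abs (\det M) = 1 -> mxint (invmx M).
Proof.
move=> M1 detM; have Mu : M \in unitmx.
  by rewrite unitmxE unitfE -(absval_eq0 abs) detM oner_eq0.
rewrite /invmx Mu; apply: mxintZ; first by rewrite absV detM invr1.
move=> i j; rewrite mxE /cofactor absvalM absX absN abs1 expr1n mul1r.
apply: abs_le_sum => // t _; rewrite absvalM absX absN abs1 expr1n mul1r.
elim/big_ind: _ => [|x y x1 y1|m _]; first by rewrite abs1.
  by rewrite -[1]mulr1 abs_leM.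
by rewrite !mxE.
Qed.

End IntegralMatrices.

Section Connection.
Variables (n g : nat) (K : fieldType) (i : 'I_n).

(** [H_KZ] without its factor [1 / q], whose place is taken by [- N_s] at level [s]. *)
Definition H_KZ1 (z : 'rV[K]_n) : 'M[K]_n :=
  \sum_(j < n | j != i) (z 0 i - z 0 j)^-1 *: Omega K i j.

(* By [Amx_shift] below, the derivative of [A = Amx s] with respect to [z_i] is
   [- N *: (conn_mx z (I *m A^-1) *m A)]. *)
Definition conn_mx (z : 'rV[K]_n) (M : 'M[K]_(n, g)) : 'M[K]_g :=
  \matrix_(u, b) (z 0 i ^+ u * M i b +
                  if (b < u)%N then z 0 i ^+ (u - b.+1) else 0).

Let mul_delta_mxE (a b : 'I_n) (M : 'M[K]_(n, g)) k l :
  ((delta_mx a b : 'M[K]_n) *m M) k l = (k == a)%:R * M b l.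
Proof.
rewrite mxE (bigD1 b)//= mxE eqxx andbT big1 ?addr0// => j jb.
by rewrite mxE (negPf jb) andbF mul0r.
Qed.

Lemma H_KZ1E (z : 'rV[K]_n) (M : 'M[K]_(n, g)) k l :
  (H_KZ1 z *m M) k l = if k == i
    then \sum_(j < n | j != i) (z 0 i - z 0 j)^-1 * (M j l - M i l)
    else (z 0 i - z 0 k)^-1 * (M i l - M k l).
Proof.
rewrite mulmx_suml summxE.
have OmE j : j != i -> (Omega K i j *m M) k l =
    (k == i)%:R * (M j l - M i l) + (k == j)%:R * (M i l - M j l).
  have addE (A B : 'M[K]_(n, g)) : (A + B) k l = A k l + B k l by rewrite mxE.
  have oppE (A : 'M[K]_(n, g)) : (- A) k l = - A k l by rewrite mxE.
  by rewrite /Omega !mulmxBl mulmxDl !(addE, oppE) !mul_delta_mxE => _; ring.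
under eq_bigr => j ji do rewrite -scalemxAl mxE OmE//.
have [->|ki] := eqVneq k i.
  by apply: eq_bigr => j ji; rewrite [i == j]eq_sym (negPf ji) ?eqxx mul1r
    mul0r addr0.
rewrite (bigD1 k)//= eqxx big1 ?addr0 ?mul0r ?add0r ?mul1r// => j /andP[_ jk].
by rewrite eq_sym (negPf jk) !mul0r addr0 mulr0.
Qed.

End Connection.

Lemma abs_coef_le1 (R : realType) (K : fieldType) (abs : nonarch_absval R K)
    (E : {poly K}) k :
  E \is a polyOver (integral_elt abs) -> abs E`_k <= 1.
Proof. by move=> /polyOverP/(_ k). Qed.

(** * The differential equation at a point of the domain *)

Section Derivative.
Variables (R : realType) (K : fieldType) (abs : nonarch_absval R K).
Variables (p q e g n : nat).
Hypotheses (pr_p : prime p) (odd_p : odd p) (q_gt1 : (1 < q)%N).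
Hypotheses (e_gt0 : (0 < e)%N) (e_order : p ^ e = 1 %[mod q]).
Hypotheses (n_def : n = (g * q + 1)%N) (n_lt_pe : (n < p ^ e)%N).
Hypothesis abs_pE : abs p%:R = p%:R^-1.
Hypothesis complete : forall x : nat -> K, abs_cauchy abs x ->
  exists l, abs_cvg abs x l.

Local Notation vp := (abs p%:R).
Local Notation P s := (p ^ (e * s))%N.
Local Notation N s := (expo p q e s).

Let p_gt1 : (1 < p)%N := prime_gt1 pr_p.

Let vp_lt1 : vp < 1 := abs_p_lt1 pr_p abs_pE.

Lemma abs_PX s : abs (P s)%:R = vp ^+ (e * s).
Proof. by rewrite natrX absX. Qed.

Lemma expo_mulq s : (N s)%:R * q%:R = (P s)%:R - 1 :> K.
Proof. by rewrite -natrM expoK// natrB ?expn_gt0 ?(ltnW p_gt1). Qed.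

Lemma abs_expo_mulq s : (0 < s)%N -> abs ((N s)%:R * q%:R) = 1.
Proof.
move=> s_gt0; rewrite expo_mulq absB -[RHS](abs1 abs); apply: abs_lt_eq.
rewrite abs1 addrAC subrr add0r absN abs_PX exprn_ilt1 ?absval_ge0//.
by rewrite muln_eq0 negb_or -!lt0n e_gt0.
Qed.

(** [q N_1 = P - 1] is a unit and both of its factors are integral. *)
Lemma abs_q : abs q%:R = 1.
Proof.
have := abs_expo_mulq (ltn0Sn 0); rewrite absvalM => NqE.
apply/eqP; rewrite eq_le abs_nat -NqE ler_piMl ?absval_ge0 ?abs_nat//.
Qed.

Lemma abs_expo s : (0 < s)%N -> abs (N s)%:R = 1.
Proof. by move=> /abs_expo_mulq; rewrite absvalM abs_q mulr1. Qed.

Lemma cvg_expo : abs_cvg abs (fun s => - (N s)%:R) q%:R^-1.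
Proof.
move=> eps eps0; have [M ltM] := abs_pX_small pr_p abs_pE eps0.
exists M => s Ms.
have q0 : q%:R != 0 :> K by rewrite -(absval_eq0 abs) abs_q oner_eq0.
have -> : - (N s)%:R - q%:R^-1 = - ((P s)%:R / q%:R) :> K.
  apply: (mulIf q0); rewrite mulrBl mulNr expo_mulq mulVf// mulNr divfK//.
  by rewrite opprB addrAC subrr add0r.
rewrite absN absvalM absV abs_q invr1 mulr1 abs_PX ltM//.
by rewrite (leq_trans Ms)// leq_pmull.
Qed.

Lemma deriv_Phi s (z : 'rV[K]_n) :
  (Phi p q e s z)^`() = (\sum_(k < n) PhiD p q e s z k) *+ N s.
Proof.
rewrite /Phi -/(root_poly z) -/(expo p q e s) deriv_exp; congr (_ *+ _).
rewrite -mulr_suml; congr (_ * _); rewrite /root_poly.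
have derivE (r : seq 'I_n) : uniq r ->
   (\prod_(i <- r) ('X - (z 0 i)%:P))^`() =
   \sum_(k <- r) \prod_(i <- r | i != k) ('X - (z 0 i)%:P).
  elim: r => [|j r IHr] /=; first by rewrite !big_nil derivC.
  move=> /andP[jr ur]; rewrite !big_cons eqxx /= derivM derivXsubC mul1r IHr//.
  congr (_ + _).
    rewrite big_seq [RHS]big_seq_cond; apply: eq_bigl => k.
    by case: (boolP (k \in r)) => //= kr; apply/esym;
      apply: contraNneq jr => <-.
  rewrite mulr_sumr big_seq [RHS]big_seq; apply: eq_bigr => k kr.
  by rewrite big_cons ifT//; apply: contraNneq jr => ->.
by rewrite derivE// index_enum_uniq.
Qed.

(* Compare the coefficients of degree [l.+1 * p ^ (e * s) - 1] in
   [Phi^`() = N *: sum_k Phi / ('X - z_k)]. *)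
Lemma sum_Igen s (z : 'rV[K]_n) (l : 'I_g) : (0 < s)%N ->
  (N s)%:R * \sum_k Igen p q e g s z k l =
  (l.+1 * P s)%:R * (Phi p q e s z)`_(l.+1 * P s).
Proof.
move=> s_gt0; have lP_gt0 : (0 < l.+1 * P s)%N.
  by rewrite muln_gt0 expn_gt0 (ltnW p_gt1).
have := congr1 (fun f : {poly K} => f`_(l.+1 * P s - 1)) (deriv_Phi s z).
rewrite coef_deriv subn1 prednK// coefMn coef_sum !mulr_natl => ->.
by congr (_ *+ _); apply: eq_bigr => k _; rewrite mxE subn1.
Qed.

Section AtPoint.
Variables (a : 'rV[K]_n) (i : 'I_n).
Hypotheses (aD : D_KZ p q e g abs a) (ai : regular_KZ i a).

Let a_le j : a 0 j \in integral_elt abs.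
Proof. by case: aD => /(_ j). Qed.

Let Amx_unit s : (0 < s)%N -> Amx p q e g s a \in unitmx.
Proof.
move=> s_gt0; rewrite unitmxE unitfE -(absval_eq0 abs).
have [detA _ _ _ _] := ratio_dist pr_p odd_p q_gt1 e_gt0 e_order n_def n_lt_pe
  abs_pE complete aD.
by rewrite detA// oner_eq0.
Qed.

Let ratioK s : (0 < s)%N ->
  Iratio p q e g s a *m Amx p q e g s a = Igen p q e g s a.
Proof.
move=> s_gt0; rewrite /Iratio mulmxKV ?Amx_unit//.
exact: Imx_Igen.
Qed.

Lemma mxint_Amx s (z : 'rV[K]_n) : (forall j, z 0 j \in integral_elt abs) ->
  mxint abs (Amx p q e g s z).
Proof.
move=> Sz u v; rewrite mxE; apply: abs_coef_le1.
by rewrite rpredX//; exact: polyOver_root_poly.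
Qed.

Lemma Amx_shift s h : (0 < s)%N -> h \in integral_elt abs ->
  exists2 E, mxint abs E & Amx p q e g s (a + h *: delta_mx 0 i) =
    Amx p q e g s a
    - (h *+ N s) *: (conn_mx i a (Iratio p q e g s a) *m Amx p q e g s a)
    + h ^+ 2 *: E.
Proof.
move=> s_gt0 Sh; have [E SE EE] := Phi_shift p q e s i a_le Sh.
exists (\matrix_(u, v) E`_(P s * v.+1 - u.+1)).
  by move=> u v; rewrite mxE; exact: abs_coef_le1.
apply/matrixP => u v; rewrite [LHS]mxE EE coefD coefB !coefZ.
have addE (A B : 'M[K]_g) : (A + B) u v = A u v + B u v by rewrite mxE.
have oppE (A : 'M[K]_g) : (- A) u v = - A u v by rewrite mxE.
have scaleE c (A : 'M[K]_g) : (c *: A) u v = c * A u v by rewrite mxE.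
rewrite !(addE, oppE, scaleE); congr (_ - _ * _ + _ * _); rewrite ?mxE//.
have ur : (u < P s * v.+1)%N.
  apply: (@leq_trans (P s)); last by rewrite leq_pmulr.
  have gn : (g <= n)%N by rewrite n_def addn1 leqW// leq_pmulr// ltnW.
  apply: leq_trans (leq_trans (ltnW n_lt_pe) _); first exact: leq_trans gn.
  by rewrite leq_exp2l// leq_pmulr.
rewrite coef_PhiD_down//; last exact: PhiDE.
under [RHS]eq_bigr do rewrite mxE mulrDl -mulrA.
rewrite big_split /= -mulr_sumr; congr (_ * _ + _).
  (* The [i]-th row of [I_s] is written as that of [I_s A_s^-1 A_s], so that [A_s] factors out on
     the right. *)
  transitivity ((Iratio p q e g s a *m Amx p q e g s a) i v);
    last by rewrite mxE.
  by rewrite ratioK// mxE mulnC.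
rewrite (big_ord_widen _ (fun b => a 0 i ^+ (u - b.+1) *
  (Phi p q e s a)`_(P s * v.+1 - b.+1)) (ltnW (ltn_ord u))) big_mkcond /=.
by apply: eq_bigr => b _; rewrite mxE; case: ifP => _; rewrite ?mul0r.
Qed.


(** The defect of the KZ equation for [I_s], in row [i] only: it comes from differentiating the
    right-hand side of [sum_Igen], where [d_i Phi_s] is [- N_s] times [PhiD]. *)
Definition Igen_err s : 'M[K]_(n, g) := \matrix_(k, l)
  if k == i then l.+1%:R * (PhiD p q e s a i)`_(l.+1 * P s) else 0.

Definition Igen_deriv s : 'M[K]_(n, g) :=
  - (N s)%:R *: (H_KZ1 i a *m Igen p q e g s a) - (P s)%:R *: Igen_err s.

Let DD s k l := (PhiDD p q e s a i k)`_(l * P s - 1).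

(** A form without denominators: integrality is visible, however close [a] is to a diagonal. *)
Let Igen_derivE s k (l : 'I_g) : (0 < s)%N -> Igen_deriv s k l =
  if k == i then (N s)%:R * \sum_(j < n | j != i) DD s j l.+1
                 - (l.+1 * P s)%:R * (PhiD p q e s a i)`_(l.+1 * P s)
  else - (N s)%:R * DD s k l.+1.
Proof.
move=> s_gt0; have addE (A B : 'M[K]_(n, g)) : (A + B) k l = A k l + B k l by
  rewrite mxE.
have oppE (A : 'M[K]_(n, g)) : (- A) k l = - A k l by rewrite mxE.
have scaleE c (A : 'M[K]_(n, g)) : (c *: A) k l = c * A k l by rewrite mxE.
rewrite !(addE, oppE, scaleE) [X in _ - _ * X]mxE H_KZ1E.
have DDE j : j != i -> DD s j l.+1 =
    (a 0 i - a 0 j)^-1 * (Igen p q e g s a i l - Igen p q e g s a j l).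
  move=> ji; rewrite /DD; have nz : a 0 j - a 0 i != 0 by rewrite subr_eq0
    eq_sym ai.
  have := PhiDDE a ji (expo_gt0 p_gt1 e_gt0 e_order s_gt0).
  move=> /(congr1 (fun f : {poly K} => f`_(l.+1 * P s - 1))).
  rewrite coefZ coefB => /(canRL (mulKf nz)) ->.
  by rewrite -[_ - a 0 j]opprB invrN mulNr -mulrN opprB !mxE.
have [ki|ki] := eqVneq k i; last by rewrite mulr0 subr0 DDE.
rewrite mulNr -mulrN -sumrN natrM mulrCA mulrA; congr (_ * _ - _).
  by apply: eq_bigr => j ji; rewrite DDE// -mulrN opprB.
Qed.

Lemma Igen_shift s h : (0 < s)%N -> h \in integral_elt abs ->
  mxint abs (Igen_deriv s) /\
  exists2 E, mxint abs E & Igen p q e g s (a + h *: delta_mx 0 i) =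
    Igen p q e g s a + h *: Igen_deriv s + h ^+ 2 *: E.
Proof.
move=> s_gt0 Sh; have N_gt0 := expo_gt0 p_gt1 e_gt0 e_order s_gt0.
have N1 := abs_expo s_gt0.
have N0 : (N s)%:R != 0 :> K by rewrite -(absval_eq0 abs) N1 oner_eq0.
have DD1 k l : abs (DD s k l) <= 1.
  apply: abs_coef_le1; exact: polyOver_PhiDD.
have SPhiD : PhiD p q e s a i \is a polyOver (integral_elt abs).
  by rewrite rpredM ?rpredX//; exact: polyOver_root_poly.
have le1M x y : abs x <= 1 -> abs y <= 1 -> abs (x * y) <= 1.
  by move=> x1 y1; rewrite -[1]mulr1 abs_leM.
split.
  move=> k l; rewrite Igen_derivE//; case: ifP => _.
    apply: abs_leB; first by apply: le1M; rewrite ?abs_nat// abs_le_sum.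
    by apply: le1M; rewrite ?abs_nat// abs_coef_le1.
  by rewrite le1M// absN N1.
have /choice[E EP] k : exists E, k != i -> E \is a polyOver (integral_elt abs)
  /\
    PhiD p q e s (a + h *: delta_mx 0 i) k =
    PhiD p q e s a k - (h *+ N s) *: PhiDD p q e s a i k + h ^+ 2 *: E.
  have [->|ki] := eqVneq k i; first by exists 0.
  by have [E SE EE] := PhiD_shift a_le Sh ki N_gt0; exists E.
have [F SF FE] := Phi_shift p q e s i a_le Sh.
pose Eoff k l := (E k)`_(l * P s - 1).
have off k l : k != i -> Igen p q e g s (a + h *: delta_mx 0 i) k l =
    Igen p q e g s a k l + h * (- (N s)%:R * DD s k l.+1) + h ^+ 2 * Eoff k
      l.+1.
  move=> ki; have [_ EE] := EP k ki; rewrite !mxE EE coefD coefB !coefZ.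
  by rewrite -mulr_natr /DD /Eoff; ring.
exists (\matrix_(k, l) if k == i
  then (N s)%:R^-1 * (l.+1 * P s)%:R * F`_(l.+1 * P s) - \sum_(j < n | j != i)
    Eoff j l.+1
  else Eoff k l.+1).
  have Eoff1 k l : k != i -> abs (Eoff k l) <= 1.
    by move=> ki; have [SE _] := EP k ki; exact: abs_coef_le1.
  move=> k l; rewrite mxE; case: eqVneq => [_|ki]; last exact: Eoff1.
  apply: abs_leB; last by apply: abs_le_sum => // j ji; exact: Eoff1.
  by rewrite !le1M ?abs_nat ?absV ?N1 ?invr1// abs_coef_le1.
apply/matrixP => k l.
have addE (A B : 'M[K]_(n, g)) : (A + B) k l = A k l + B k l by rewrite mxE.
have scaleE c (A : 'M[K]_(n, g)) : (c *: A) k l = c * A k l by rewrite mxE.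
rewrite 2!addE scaleE Igen_derivE// scaleE [X in _ + _ * X]mxE.
case: eqVneq => [->|ki]; last exact: off.
(* Row [i] is recovered from the other rows through [sum_Igen], as [N_s] is a unit. *)
have rowE (z : 'rV[K]_n) : Igen p q e g s z i l =
    (N s)%:R^-1 * (l.+1 * P s)%:R * (Phi p q e s z)`_(l.+1 * P s) -
    \sum_(j < n | j != i) Igen p q e g s z j l.
  by rewrite -mulrA -sum_Igen// mulKf// (bigD1 i)//= addrK.
rewrite !rowE FE coefD coefB !coefZ (eq_bigr _ (fun j ji => off j l ji)).
rewrite !big_split /= -!mulr_sumr -mulr_natr.
by field.
Qed.


Lemma mxint_conn (M : 'M[K]_(n, g)) : mxint abs M -> mxint abs (conn_mx i a M).
Proof.
move=> M1 u b; rewrite mxE; have aX1 k : abs (a 0 i ^+ k) <= 1.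
  by rewrite absX exprn_ile1 ?absval_ge0//; exact: a_le.
apply: abs_leD; last by case: ifP; rewrite ?abs0.
by rewrite -[1]mulr1 abs_leM.
Qed.

(** The quotient rule for [I_s A_s^-1]; the right factor [A_s] of [d_i A_s] cancels one inverse. *)
Let Iratio_deriv s : 'M[K]_(n, g) :=
  - (N s)%:R *: (H_KZ1 i a *m Iratio p q e g s a
                 - Iratio p q e g s a *m conn_mx i a (Iratio p q e g s a))
  - (P s)%:R *: (Igen_err s *m invmx (Amx p q e g s a)).

Let D_dist (b : 'rV[K]_n) (bD : D_KZ p q e g abs b) :=
  ratio_dist pr_p odd_p q_gt1 e_gt0 e_order n_def n_lt_pe abs_pE complete bD.

Let Iratio_shift s h k l : (0 < s)%N -> abs h <= 1 ->
    D_KZ p q e g abs (a + h *: delta_mx 0 i) ->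
  abs (Iratio p q e g s (a + h *: delta_mx 0 i) k l - Iratio p q e g s a k l
       - h * Iratio_deriv s k l) <= abs h ^+ 2.
Proof.
set a' := a + _ => s_gt0 h1 a'D.
have [detA' rho'1 _ _ _] := D_dist a'D.
have [detA rho1 _ _ _] := D_dist aD.
have A1 := mxint_Amx s a_le.
have invA1 := mxint_inv A1 (detA s s_gt0).
have invA'1 := mxint_inv (mxint_Amx s (proj1 a'D)) (detA' s s_gt0).
have A'u : Amx p q e g s a' \in unitmx.
  by rewrite unitmxE unitfE -(absval_eq0 abs) detA'// oner_eq0.
have [EA EA1] := Amx_shift s_gt0 h1.
have [I1 [EI EI1]] := Igen_shift s_gt0 h1.
rewrite -/a' => IE AE.
pose C := conn_mx i a (Iratio p q e g s a).
pose T := - (N s)%:R *: (C *m Amx p q e g s a).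
have T1 : mxint abs T.
  apply: mxintZ; first by rewrite absN abs_expo.
  by apply: mxintM => //; apply: mxint_conn => ? ?; exact: rho1.
have {}AE : Amx p q e g s a' = Amx p q e g s a + h *: T + h ^+ 2 *: EA.
  rewrite AE /T -/C; congr (_ + _ + _).
  by rewrite scalerA mulrN -[h *+ _]mulr_natr scaleNr.
pose rho := Iratio p q e g s a; pose rho' := Iratio p q e g s a'.
have DE : Iratio_deriv s = (Igen_deriv s - rho *m T) *m invmx (Amx p q e g s a).
  rewrite /Iratio_deriv /Igen_deriv -ratioK// /T -/C -/rho.
  rewrite -scalemxAr !mulmxBl -!scalemxAl !mulmxA !mulmxK ?Amx_unit//.
  by rewrite scalerBr addrAC.
have DA : Iratio_deriv s *m Amx p q e g s a = Igen_deriv s - rho *m T.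
  by rewrite DE mulmxKV ?Amx_unit.
have rho_mxint : mxint abs rho by move=> ? ?; exact: rho1.
have D1 : mxint abs (Iratio_deriv s).
  by rewrite DE; apply: mxintM => //; apply: mxintB => //; exact: mxintM.
pose X := EI - rho *m EA - Iratio_deriv s *m T - h *: (Iratio_deriv s *m EA).
have X1 : mxint abs X.
  by rewrite /X; do !apply: mxintB => //; [| |apply: mxintZ => //];
    exact: mxintM.
have rho'E : rho' *m Amx p q e g s a' = Igen p q e g s a'.
  by rewrite /rho' /Iratio mulmxKV// Imx_Igen.
(* After multiplication by the matrix [A_s] of the shifted point, the terms of order 0 and 1 in [h]
   cancel and the integral matrix [X] remains. *)
clearbody T; have key : (rho' - rho - h *: Iratio_deriv s) *m Amx p q e g s a'
  = h ^+ 2 *: X.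
  rewrite !mulmxBl rho'E IE -scalemxAl AE !mulmxDr -!scalemxAr DA -/rho
    ratioK// /X.
  move: (rho *m T) (rho *m EA) (Iratio_deriv s *m T) (Iratio_deriv s *m EA).
  move: (Igen _ _ _ _ _ _) (Igen_deriv s) => M1 M2 M3 M4 M5 M6.
  by apply/matrixP => x y; rewrite !mxE; ring.
have -> : rho' k l - rho k l - h * Iratio_deriv s k l =
    (h ^+ 2 *: (X *m invmx (Amx p q e g s a'))) k l.
  by rewrite scalemxAl -key mulmxK// !mxE.
rewrite mxE absvalM absX ler_piMr ?exprn_ge0 ?absval_ge0//.
by apply: mxintM.
Qed.

Let cvg_Iratio_deriv k l : abs_cvg abs (fun s => Iratio_deriv s k l)
  ((H_KZ q i a *m Ilim p q e g abs a
    - q%:R^-1 *: (Ilim p q e g abs a *m conn_mx i a (Ilim p q e g abs a))) k l).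
Proof.
have [detA rho1 rho_cvg _ _] := D_dist aD.
have err_cvg : abs_cvg abs
    (fun s => (P s)%:R * (Igen_err s *m invmx (Amx p q e g s a)) k l) 0.
  move=> eps /(abs_pX_small pr_p abs_pE)[M ltM]; exists M.+1 => s Ms.
  have s_gt0 : (0 < s)%N by exact: leq_trans Ms.
  rewrite subr0 absvalM abs_PX (@le_lt_trans _ _ (vp ^+ (e * s)))//.
    rewrite ler_piMr ?exprn_ge0 ?absval_ge0//; apply: mxintM.
      move=> x y; rewrite mxE; case: ifP => _; last by rewrite abs0.
      rewrite -[X in _ <= X]mulr1 abs_leM ?abs_nat// abs_coef_le1//.
      by rewrite rpredM ?rpredX//; exact: polyOver_root_poly.
    by apply: mxint_inv; [exact: mxint_Amx | exact: detA].
  by apply: ltM; rewrite (leq_trans (ltnW Ms))// leq_pmull.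
have H_cvg : abs_cvg abs (fun s => (H_KZ1 i a *m Iratio p q e g s a) k l)
    ((H_KZ1 i a *m Ilim p q e g abs a) k l).
  rewrite mxE; under eq_fun do rewrite mxE.
  by apply: abs_cvg_sum => x _; apply: abs_cvgM => //; exact: abs_cvg_cst.
have C_cvg x y : abs_cvg abs (fun s => conn_mx i a (Iratio p q e g s a) x y)
    (conn_mx i a (Ilim p q e g abs a) x y).
  rewrite mxE; under eq_fun do rewrite mxE.
  apply: abs_cvgD; last exact: abs_cvg_cst.
  by apply: abs_cvgM => //; exact: abs_cvg_cst.
have IC_cvg : abs_cvg abs
    (fun s => (Iratio p q e g s a *m conn_mx i a (Iratio p q e g s a)) k l)
    ((Ilim p q e g abs a *m conn_mx i a (Ilim p q e g abs a)) k l).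
  rewrite mxE; under eq_fun do rewrite mxE.
  by apply: abs_cvg_sum => x _; exact: abs_cvgM.
have := abs_cvgD (abs_cvgM cvg_expo (abs_cvgD H_cvg
  (abs_cvgM (abs_cvg_cst abs (-1)) IC_cvg)))
  (abs_cvgM (abs_cvg_cst abs (-1)) err_cvg).
have addE (A B : 'M[K]_(n, g)) : (A + B) k l = A k l + B k l by rewrite mxE.
have oppE (A : 'M[K]_(n, g)) : (- A) k l = - A k l by rewrite mxE.
have scaleE c (A : 'M[K]_(n, g)) : (c *: A) k l = c * A k l by rewrite mxE.
congr (abs_cvg _ _ _).
  apply/funext => s; rewrite /Iratio_deriv addE oppE 2!scaleE addE oppE.
  by rewrite !mulN1r.
rewrite /H_KZ -/(H_KZ1 i a) -scalemxAl -scalerBr scaleE addE oppE.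
by rewrite mulr0 addr0 mulN1r.
Qed.

(** The bound [|h| <= |p|] keeps the shifted point in the domain, and the uniform estimate
    [Iratio_shift] passes to the limit. *)
Lemma Ilim_shift h k l : abs h <= vp ->
  abs (Ilim p q e g abs (a + h *: delta_mx 0 i) k l - Ilim p q e g abs a k l
       - h * (H_KZ q i a *m Ilim p q e g abs a
              - q%:R^-1 *: (Ilim p q e g abs a *m
                            conn_mx i a (Ilim p q e g abs a))) k l) <= abs h
                              ^+ 2.
Proof.
move=> h_le; have h1 : abs h <= 1 by rewrite (le_trans h_le)// ltW.
have w_in : `[< forall j, abs ((delta_mx 0 i : 'rV[K]_n) 0 j) <= 1 >].
  by apply/asboolP => j; rewrite mxE abs_nat.
have a'D : D_KZ p q e g abs (a + h *: delta_mx 0 i).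
  pose w : unit_polydisc abs n := exist _ (delta_mx 0 i) w_in.
  exact: (polydisc_D pr_p odd_p q_gt1 e_gt0 e_order n_def n_lt_pe abs_pE w aD).
have [_ _ rho_cvg _ _] := D_dist aD; have [_ _ rho'_cvg _ _] := D_dist a'D.
have := abs_cvgD (abs_cvgD (rho'_cvg k l)
  (abs_cvgM (abs_cvg_cst abs (-1)) (rho_cvg k l)))
  (abs_cvgM (abs_cvg_cst abs (- h)) (cvg_Iratio_deriv k l)).
rewrite mulN1r mulNr => dcvg.
apply: (@abs_cvg_le _ _ _ _ _ _ 1 dcvg) => s s_gt0; rewrite mulN1r mulNr.
exact: Iratio_shift.
Qed.

End AtPoint.
End Derivative.

(** * Analytic functions *)

Section PowerSeries.
Variables (R : realType) (K : fieldType) (abs : nonarch_absval R K) (n p : nat).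
Hypotheses (pr_p : prime p) (abs_pE : abs p%:R = p%:R^-1).
Hypothesis complete : forall x : nat -> K, abs_cauchy abs x ->
  exists l, abs_cvg abs x l.

Local Notation vp := (abs p%:R).
Local Notation eval w Q := (meval (val w 0) Q).
Local Notation exponent := {ffun 'I_n -> nat}.

Let vp_lt1 : vp < 1 := abs_p_lt1 pr_p abs_pE.

Let vp_gt0 : 0 < vp := abs_p_gt0 pr_p abs_pE.

Let vpX_le1 k : vp ^+ k <= 1.
Proof. by rewrite exprn_ile1// ltW. Qed.

Definition mnm_of (k : exponent) : 'X_{1..n} := [multinom k i | i < n].

Definition of_mnm (m : 'X_{1..n}) : exponent := [ffun i => m i].

Lemma mnm_ofK : cancel mnm_of of_mnm.
Proof. by move=> k; apply/ffunP => i; rewrite ffunE mnmE. Qed.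

Lemma of_mnmK : cancel of_mnm mnm_of.
Proof. by move=> m; apply/mnmP => i; rewrite mnmE ffunE. Qed.

Lemma meval_mnm_of (v : 'I_n -> K) k :
  meval v 'X_[mnm_of k] = \prod_j v j ^+ k j.
Proof. by rewrite mevalX; apply: eq_bigr => j _; rewrite mnmE. Qed.

Lemma abs_monomial (w : unit_polydisc abs n) (k : exponent) :
  abs (\prod_j val w 0 j ^+ k j) <= 1.
Proof.
elim/big_ind: _ => [|x y x1 y1|j _]; first by rewrite abs1.
  by rewrite -[X in _ <= X]mulr1 abs_leM.
by rewrite absX exprn_ile1 ?absval_ge0 ?unit_polydiscP.
Qed.

Lemma meval_support (v : 'I_n -> K) (Q : {mpoly K[n]}) (J : {fset exponent}) :
    (forall m, m \in msupp Q -> of_mnm m \in J) ->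
  meval v Q = \sum_(k <- J) Q@_(mnm_of k) * \prod_j v j ^+ k j.
Proof.
move=> QJ; rewrite mevalE.
transitivity (\sum_(m <- [seq mnm_of k | k <- J]) Q@_m * \prod_j v j ^+ m j).
  rewrite [RHS](bigID (fun m => m \in msupp Q)) /= [X in _ + X]big1 ?addr0.
    rewrite -[RHS]big_filter; apply: perm_big; apply: uniq_perm.
    - exact: msupp_uniq.
    - by rewrite filter_uniq// map_inj_uniq ?fset_uniq//;
      exact: can_inj mnm_ofK.
    move=> m; rewrite mem_filter; case: (boolP (m \in msupp Q)) => //= /QJ mJ.
    by apply/esym/mapP; exists (of_mnm m); rewrite ?of_mnmK.
  by move=> m /memN_msupp_eq0 ->; rewrite mul0r.
rewrite big_map; apply: eq_bigr => k _; congr (_ * _).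
by apply: eq_bigr => j _; rewrite mnmE.
Qed.

Variables (u : 'rV[K]_n) (pi : K).
Hypothesis pi_neq0 : pi != 0.

Let term_pt (c : exponent -> K) (w : unit_polydisc abs n) (k : exponent) :
  c k * \prod_j (polydisc_pt u pi w 0 j - u 0 j) ^+ k j =
  c k * pi ^+ (\sum_j k j) * \prod_j val w 0 j ^+ k j.
Proof.
rewrite -mulrA; congr (_ * _); rewrite -prodrXr -big_split /=.
by apply: eq_bigr => j _; rewrite !mxE addrC addKr exprMn.
Qed.

Lemma tate_power_series (F : 'rV[K]_n -> K) :
    tate p (fun w : unit_polydisc abs n => F (polydisc_pt u pi w)) ->
  exists c, forall w : unit_polydisc abs n,
    power_series_sum abs c u (polydisc_pt u pi w) (F (polydisc_pt u pi w)).
Proof.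
move=> [Q [Q1 dQ FQ]].
have dQle m i s : (0 < i)%N -> (i <= s)%N -> abs ((Q s)@_m - (Q i)@_m) <= vp
  ^+ i.
  move=> _; elim: s => [|s IHs]; first by case: i => // _;
    rewrite subrr abs0 ltW.
  rewrite leq_eqVlt => /predU1P[->|]; first by rewrite subrr abs0 ltW//
    exprn_gt0.
  rewrite ltnS => i_s; rewrite -[(Q s.+1)@_m](subrK (Q s)@_m) -addrA.
  apply: abs_leD; last exact: IHs.
  rewrite -mcoeffB (le_trans (dQ _ _))//.
  by apply: ler_wiXn2l; rewrite ?ltW.
have /choice[c0 c0P] m : exists l, forall i, (0 < i)%N -> abs (l - (Q i)@_m)
  <= vp ^+ i.
  have [l _ dl] := limit_of_steps pr_p abs_pE complete (dQle m).
  by exists l.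
(* The limits of the coefficients of the [Q N] are coefficients in [w]; division by [pi^|k|]
   converts them to the variable [z - u = pi w]. *)
pose c (k : exponent) := c0 (mnm_of k) / pi ^+ (\sum_j k j).
exists c => w eps eps0.
have [N ltN] := abs_pX_small pr_p abs_pE eps0.
(* Outside this support the limit coefficients are at most [|p|^(N+1)], so any larger finite set
   serves as well. *)
exists [fset of_mnm m | m in msupp (Q N.+1)]%fset => J' sJJ'.
under eq_bigr do rewrite term_pt /c divfK ?expf_neq0//.
have QJ' m : m \in msupp (Q N.+1) -> of_mnm m \in J'.
  by move=> mQ; apply: (fsubsetP sJJ'); apply/imfsetP; exists m.
rewrite (@le_lt_trans _ _ (vp ^+ N.+1)) ?ltN//.
rewrite -[F _](subrK (eval w (Q N.+1))) [_ - eval w _ + _]addrC opprD addrA.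
apply: abs_leB => //; rewrite (meval_support _ QJ') -sumrB.
apply: abs_le_sum => [|k _]; first by rewrite ltW// exprn_gt0.
by rewrite -mulrBl -[X in _ <= X]mulr1 abs_leM ?c0P ?abs_monomial.
Qed.

Lemma scale_le1_mono (x : K) a b : (a <= b)%N ->
  abs (p%:R ^+ a * x) <= 1 -> abs (p%:R ^+ b * x) <= 1.
Proof.
move=> /subnK <- x1; rewrite exprD -mulrA -[X in _ <= X]mulr1.
by rewrite abs_leM// absX vpX_le1.
Qed.

Lemma scale_le1 (x : K) : exists a, abs (p%:R ^+ a * x) <= 1.
Proof.
have x0 := absval_ge0 abs x; have x1 : 0 < abs x + 1 by rewrite ltr_wpDl.
have [a lta] := abs_pX_small pr_p abs_pE (eq_ind_r is_true x1 (invr_gt0 _)).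
exists a; rewrite absvalM absX (@le_trans _ _ (vp ^+ a * (abs x + 1)))//.
  by rewrite ler_wpM2l ?exprn_ge0 ?lerDl ?ler01// ltW.
by rewrite -ler_pdivlMr// div1r ltW// lta.
Qed.

Lemma power_series_tate (c : exponent -> K) (F : 'rV[K]_n -> K) :
    (forall w : unit_polydisc abs n,
      power_series_sum abs c u (polydisc_pt u pi w) (F (polydisc_pt u pi w))) ->
  exists a, tate p (fun w : unit_polydisc abs n =>
                      p%:R ^+ a * F (polydisc_pt u pi w)).
Proof.
move=> cF; pose b (k : exponent) := c k * pi ^+ (\sum_j k j).
have vpX_gt0 N : 0 < vp ^+ N by rewrite exprn_gt0.
have w1_in : `[< forall j, abs ((const_mx 1 : 'rV[K]_n) 0 j) <= 1 >].
  by apply/asboolP => j; rewrite mxE abs1.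
pose w1 : unit_polydisc abs n := exist _ (const_mx 1) w1_in.
have w1E (k : exponent) : \prod_j val w1 0 j ^+ k j = 1.
  by apply: big1 => j _; rewrite mxE expr1n.
have /choice[J JP] N := cF w1 _ (vpX_gt0 N).
(* At [w1], all of whose coordinates are 1, the terms of the series are the [b k]. Adding one index
   outside [J N] changes the partial sum by [b k], which is therefore small. *)
have b_small N k : k \notin J N -> abs (b k) <= vp ^+ N.
  move=> kJ; have := abs_ltB (JP N _ (fsubsetU1 k (J N))) (JP N _
    (fsubset_refl _)).
  rewrite opprB addrA subrK big_fsetU1//= addrK term_pt w1E mulr1.
  exact: ltW.
(* Only indices in the finite set [J 0] can have [|b k| > 1]; a power of [p] absorbs them. *)
have [a aP] : exists a, forall k, abs (p%:R ^+ a * b k) <= 1.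
  have bound (r : seq exponent) :
      exists a, forall k, k \in r -> abs (p%:R ^+ a * b k) <= 1.
    elim: r => [|k r [a IHa]]; first by exists 0%N.
    have [a' k1] := scale_le1 (b k); exists (maxn a a') => k'; rewrite inE.
    move=> /predU1P[->|/IHa]; first exact: scale_le1_mono (leq_maxr _ _) k1.
    exact: scale_le1_mono (leq_maxl _ _).
  have [a aP] := bound (J 0%N).
  exists a => k; have [/aP//|/b_small] := boolP (k \in J 0%N).
  by rewrite expr0 -[X in _ -> _ <= X]mulr1 => b1; rewrite abs_leM// absX.
exists a; pose Q N := \sum_(k <- J N) (p%:R ^+ a * b k) *: 'X_[mnm_of k].
have QE N m : (Q N)@_m =
    if of_mnm m \in J N then p%:R ^+ a * b (of_mnm m) else 0.
  rewrite raddf_sum /=.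
  under eq_bigr do rewrite mcoeffZ mcoeffX (can2_eq mnm_ofK of_mnmK) mulr_natr
    mulrb.
  rewrite -big_mkcond /=; case: ifP => mJ.
    by rewrite -big_filter filter_pred1_uniq ?fset_uniq// big_seq1.
  rewrite big_seq_cond big1// => k /andP[kJ /eqP kE].
  by rewrite -kE kJ in mJ.
exists Q; split=> [N m|N m|N w].
- by rewrite QE; case: ifP => _; rewrite ?abs0.
- have small M k : (N <= M)%N -> k \notin J M -> abs (p%:R ^+ a * b k) <= vp
  ^+ N.
    move=> NM kJ; rewrite -[X in _ <= X]mul1r abs_leM ?absX//.
    by rewrite (le_trans (b_small _ _ kJ))//; apply: ler_wiXn2l; rewrite ?ltW.
  rewrite mcoeffB !QE; case: ifPn => mJ1; case: ifPn => mJ.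
  + by rewrite subrr abs0 ltW.
  + by rewrite subr0; exact: small mJ.
  + by rewrite sub0r absN; exact: small mJ1.
  + by rewrite subrr abs0 ltW.
(* [J N] was chosen at [w1] and need not suit [w]. It is compared with its union with a set that
   does; the extra terms are small by [b_small]. *)
- have [Jw JwP] := cF w _ (vpX_gt0 N).
  have := JwP _ (fsubsetUr (J N) Jw).
  have evalE : eval w (Q N) =
      p%:R ^+ a * \sum_(k <- J N) b k * \prod_j val w 0 j ^+ k j.
    rewrite raddf_sum mulr_sumr; apply: eq_bigr => k _.
    by rewrite /= mevalZ meval_mnm_of mulrA.
  rewrite evalE -mulrBr => lt_N; rewrite -[X in _ <= X]mul1r abs_leM ?absX//.
  pose T k := b k * \prod_j val w 0 j ^+ k j.
  have sumJ : \sum_(k <- J N) T k =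
      \sum_(k <- (J N `|` Jw)%fset) if k \in J N then T k else 0.
    rewrite -(big_fset_incl _ (fsubsetUl (J N) Jw)); last first.
      by move=> k _ /negPf ->.
    by apply: eq_big_seq => k ->.
  rewrite sumJ -(subrK (\sum_(k <- (J N `|` Jw)%fset) T k)
    (F (polydisc_pt u pi w))) -addrA abs_leD//.
    rewrite absB ltW//; move: lt_N; under eq_bigr do rewrite term_pt.
    by [].
  rewrite -sumrB; apply: abs_le_sum; first by rewrite ltW.
  move=> k _; case: ifPn => kJ; first by rewrite subrr abs0 ltW.
  by rewrite subr0 -[X in _ <= X]mulr1 abs_leM ?abs_monomial ?b_small.
Qed.

End PowerSeries.

(** * Derivatives of restricted power series *)

Section TateDerivative.
Variables (R : realType) (K : fieldType) (abs : nonarch_absval R K) (n p : nat).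
Hypotheses (pr_p : prime p) (abs_pE : abs p%:R = p%:R^-1).
Hypothesis complete : forall x : nat -> K, abs_cauchy abs x ->
  exists l, abs_cvg abs x l.
Variable i : 'I_n.

Local Notation vp := (abs p%:R).
Local Notation eval w Q := (meval (val w 0) Q).

Let vp_lt1 : vp < 1 := abs_p_lt1 pr_p abs_pE.

Let vp_gt0 : 0 < vp := abs_p_gt0 pr_p abs_pE.

Let le1M (x y : K) c : abs x <= 1 -> abs y <= c -> abs (x * y) <= c.
Proof. by move=> x1 y1; rewrite -[c]mul1r abs_leM. Qed.

Definition integral_shift (Q : {mpoly K[n]}) := forall v v' h,
  (forall j, abs (v j) <= 1) -> abs h <= 1 ->
  (forall j, v' j = v j + h * (j == i)%:R) ->
  [/\ abs (meval v Q) <= 1, abs (meval v (mderiv i Q)) <= 1 &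
      abs (meval v' Q - meval v Q - h * meval v (mderiv i Q)) <= abs h ^+ 2].

Lemma integral_shiftD Q S :
  integral_shift Q -> integral_shift S -> integral_shift (Q + S).
Proof.
move=> hQ hS v v' h v1 h1 v'E; have [Q1 dQ1 eQ] := hQ v v' h v1 h1 v'E.
have [S1 dS1 eS] := hS v v' h v1 h1 v'E.
rewrite mderivD !mevalD; split; try exact: abs_leD.
have -> : meval v' Q + meval v' S - (meval v Q + meval v S) -
    h * (meval v (mderiv i Q) + meval v (mderiv i S)) =
  (meval v' Q - meval v Q - h * meval v (mderiv i Q)) +
  (meval v' S - meval v S - h * meval v (mderiv i S)) by ring.
exact: abs_leD.
Qed.

Lemma integral_shiftM Q S :
  integral_shift Q -> integral_shift S -> integral_shift (Q * S).
Proof.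
move=> hQ hS v v' h v1 h1 v'E; have [Q1 dQ1 eQ] := hQ v v' h v1 h1 v'E.
have [S1 dS1 eS] := hS v v' h v1 h1 v'E.
have S'1 : abs (meval v' S) <= 1.
  have h2 : abs h ^+ 2 <= 1 by rewrite exprn_ile1 ?absval_ge0.
  have -> : meval v' S = (meval v' S - meval v S - h * meval v (mderiv i S)) +
      (meval v S + h * meval v (mderiv i S)) by ring.
  by apply: abs_leD; [exact: le_trans eS h2 | rewrite abs_leD// le1M].
rewrite mderivM mevalD !mevalM; split; first exact: le1M.
  by apply: abs_leD; apply: le1M.
have -> : meval v' Q * meval v' S - meval v Q * meval v S -
    h * (meval v (mderiv i Q) * meval v S + meval v Q * meval v (mderiv i S)) =
  (meval v' Q - meval v Q - h * meval v (mderiv i Q)) * meval v' S +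
  (meval v Q + h * meval v (mderiv i Q)) *
    (meval v' S - meval v S - h * meval v (mderiv i S)) +
  h ^+ 2 * (meval v (mderiv i Q) * meval v (mderiv i S)) by ring.
apply: abs_leD; first apply: abs_leD.
- by rewrite mulrC le1M.
- by apply: le1M => //; rewrite abs_leD// le1M.
- by rewrite mulrC le1M ?absX// le1M.
Qed.

Lemma integral_shiftC x : abs x <= 1 -> integral_shift x%:MP.
Proof.
move=> x1 v v' h _ _ _; rewrite mderivC meval0 !mevalC subrr mulr0 subrr abs0.
by split=> //; rewrite exprn_ge0 ?absval_ge0.
Qed.

Lemma integral_shiftXU j : integral_shift 'X_j.
Proof.
move=> v v' h v1 h1 v'E; rewrite mderivX mevalZ mevalXU mnm1E eq_sym.
have dE : (i == j)%:R * meval v 'X_[U_(j) - U_(i)] = (i == j)%:R.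
  case: eqP => [->|]; rewrite ?mul0r// mul1r -[RHS](meval1 v); congr meval.
  by rewrite -mpolyX0; congr 'X_[_]; apply/mnmP => k; rewrite mnmBE subnn mnm0E.
rewrite dE; split=> //; first exact: abs_nat.
rewrite mevalXU v'E [j == i]eq_sym addrAC addrK subrr abs0.
by rewrite exprn_ge0 ?absval_ge0.
Qed.

Lemma integral_shift_mpoly Q : gauss_le abs 1 Q -> integral_shift Q.
Proof.
move=> Q1; rewrite [Q]mpolyE; elim/big_ind: _.
- by rewrite -mpolyC0; apply: integral_shiftC; rewrite abs0.
- exact: integral_shiftD.
- move=> m _; rewrite -mul_mpolyC; apply: integral_shiftM.
    exact/integral_shiftC/Q1.
  rewrite mpolyXE_id; elim/big_ind: _.
  - by rewrite -mpolyC1; apply: integral_shiftC; rewrite abs1.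
  - exact: integral_shiftM.
  - move=> j _; elim: (m j) => [|k IHk].
      by rewrite expr0 -mpolyC1; apply: integral_shiftC; rewrite abs1.
    by rewrite exprS; apply: integral_shiftM => //; exact: integral_shiftXU.
Qed.

Lemma gauss_le_mderiv c (Q : {mpoly K[n]}) :
  gauss_le abs c Q -> gauss_le abs c (mderiv i Q).
Proof.
by move=> Qc m; rewrite mcoeff_deriv -mulr_natl le1M// abs_nat.
Qed.

Lemma tate_deriv (f : unit_polydisc abs n -> K) : tate p f ->
  exists2 f', tate p f' & forall (w w' : unit_polydisc abs n) h, abs h <= 1 ->
    val w' = val w + h *: delta_mx 0 i ->
    abs (f w' - f w - h * f' w) <= abs h ^+ 2.
Proof.
move=> [Q [Q1 dQ fQ]]; pose Q' N := mderiv i (Q N).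
have dQ' N : gauss_le abs (vp ^+ N) (Q' N.+1 - Q' N).
  by rewrite -mderivB; exact: gauss_le_mderiv.
have vpX_ge0 N : 0 <= vp ^+ N by rewrite exprn_ge0// ltW.
have vpS N : vp ^+ N.+1 <= vp ^+ N by rewrite exprS ler_piMl// ltW.
have steps (w : unit_polydisc abs n) k s : (0 < k)%N -> (k <= s)%N ->
    abs (eval w (Q' s) - eval w (Q' k)) <= vp ^+ k.
  move=> _ /subnK <-; elim: (s - k)%N => [|t IHt]; first by rewrite subrr abs0.
  rewrite -[X in X - _](subrK (eval w (Q' (t + k)%N))) -addrA abs_leD//.
  rewrite addSn -mevalB; apply: le_trans (gauss_le_eval _ (vpX_ge0 _) (dQ' _))
    _.
  by rewrite exprD ler_piMl// exprn_ile1// ltW.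
have /choice[f' f'P] (w : unit_polydisc abs n) : exists l, forall k, (0 < k)%N
  ->
    abs (l - eval w (Q' k)) <= vp ^+ k.
  by have [l _ dl] := limit_of_steps pr_p abs_pE complete (steps w); exists l.
exists f'.
  exists (fun N => Q' N.+1); split=> N; first exact: gauss_le_mderiv.
    by move=> m; rewrite (le_trans (dQ' _ _)).
  by move=> w; rewrite (le_trans (f'P _ _ _)).
move=> w w' h h1 w'E; have [h0|h_neq0] := eqVneq h 0.
  suff -> : w' = w by rewrite h0 mul0r subrr subr0 abs0 exprn_ge0.
  by apply: val_inj; rewrite w'E h0 scale0r addr0.
have h2 : 0 < abs h ^+ 2 by rewrite exprn_gt0// abs_gt0.
(* The approximation is taken so fine that its errors are below [|h|^2]; this is why [h = 0] was set
   aside. *)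
have [N ltN] := abs_pX_small pr_p abs_pE h2.
have le_N : vp ^+ N.+1 <= abs h ^+ 2 by rewrite ltW// ltN.
have w'Ej j : val w' 0 j = val w 0 j + h * (j == i)%:R by rewrite w'E !mxE eqxx.
have [_ _ eQ] := integral_shift_mpoly (Q1 N.+1) (unit_polydiscP w) h1 w'Ej.
rewrite -/(Q' N.+1) in eQ.
have -> : f w' - f w - h * f' w =
  (eval w' (Q N.+1) - eval w (Q N.+1) - h * eval w (Q' N.+1)) +
  ((f w' - eval w' (Q N.+1)) - (f w - eval w (Q N.+1))
   - h * (f' w - eval w (Q' N.+1))) by ring.
apply: abs_leD => //; apply: abs_leB; first apply: abs_leB.
- by rewrite (le_trans (fQ _ _)).
- by rewrite (le_trans (fQ _ _)).
- by apply: le1M => //; rewrite (le_trans (f'P _ _ _)).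
Qed.

End TateDerivative.

(** * Unramified extensions of the p-adic field *)

Section UnramifiedExtension.
Variables (R : realType) (p m : nat) (Qp : fieldType).
Variables (absQp : nonarch_absval R Qp) (K : fieldExtType Qp).
Variable (abs : nonarch_absval R K).
Hypotheses (pr_p : prime p) (QpP : is_Qp p absQp).
Hypothesis KP : is_unramified_ext absQp abs m.

Lemma abs_p : abs p%:R = p%:R^-1.
Proof.
have -> : p%:R = (p%:R : Qp)%:A :> K by rewrite scaler_nat.
rewrite (unram_extends KP) -[p%:R in LHS](ratr_nat Qp) (Qp_norm QpP)
  /padic_norm.
rewrite pnatr_eq0 eqn0Ngt prime_gt0//=.
have -> : (p%:R : rat) = (p%:Z)%:Q by rewrite -pmulrn.
by rewrite numq_int denq_int /= logn1 logn_prime// eqxx.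
Qed.

(** The value group is that of the base field, and a rational close enough to a nonzero element has
    the same absolute value. *)
Lemma value_group x : x != 0 -> exists k : int, abs x = p%:R ^ k.
Proof.
move=> x0; have [y xy] := unram_value_group KP x.
have y0 : 0 < absQp y by rewrite -xy abs_gt0.
have [z zy] := Qp_dense QpP y y0.
have zE : absQp (ratr z) = absQp y by apply: abs_lt_eq; rewrite absB.
rewrite xy -zE (Qp_norm QpP) /padic_norm; case: eqP => [z0|_].
  by move: y0; rewrite -zE (Qp_norm QpP) /padic_norm z0 eqxx ltxx.
by exists ((logn p `|denq z|)%:Z - (logn p `|numq z|)%:Z).
Qed.

Definition complete_space (V : {vspace K}) := forall x : nat -> K,
  (forall k, x k \in V) -> abs_cauchy abs x -> exists2 l, l \in V & abs_cvg
    abs x l.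

(* If [v] is not in the complete, hence closed, span [V] of [X], then it is at a
   positive distance from [V], so that the coefficients of [v] in a Cauchy
   sequence of [V + <[v]>] form a Cauchy sequence. *)
Lemma complete_span (X : seq K) : complete_space <<X>>%VS.
Proof.
elim: X => [|v X IHX] x xX x_cauchy.
  exists 0; first exact: mem0v.
  suff -> : x = fun=> 0 by exact: abs_cvg_cst.
  by apply/funext => k; have := xX k; rewrite span_nil memv0 => /eqP.
have [vX|vX] := boolP (v \in <<X>>%VS).
  have span_eq : <<v :: X>>%VS = <<X>>%VS.
    by rewrite span_cons; apply/addv_idPr; rewrite -memvE.
  rewrite span_eq in xX *; exact: IHX.
have [d d0 dist] : exists2 d : R, 0 < d & forall w, w \in <<X>>%VS -> d <= abs
  (v - w).
  apply: contrapT => no_d.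
  have near k : exists w, w \in <<X>>%VS /\ abs (v - w) < k.+1%:R^-1.
    apply: contrapT => no_w; apply: no_d; exists k.+1%:R^-1;
      first by rewrite invr_gt0.
    by move=> w wX; rewrite leNgt; apply/negP => lt_w; apply: no_w; exists w.
  have /choice[w wP] := near.
  have w_cvg : abs_cvg abs w v.
    move=> eps eps0; exists (Num.bound eps^-1) => k Nk.
    have [_ lt_k] := wP k; rewrite absB (lt_trans lt_k)//.
    rewrite -[eps]invrK ltf_pV2 ?posrE ?invr_gt0//.
    apply: lt_le_trans (archi_boundP _) _; first by rewrite invr_ge0 ltW.
    by rewrite ler_nat leqW.
  have w_cauchy : abs_cauchy abs w.
    move=> eps /w_cvg[N wN]; exists N => k l Nk Nl.
    by rewrite -[w k](subrK v) -addrA abs_ltD ?wN// absB wN.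
  have [l lX w_l] := IHX w (fun k => proj1 (wP k)) w_cauchy.
  by rewrite (abs_cvg_unique w_cvg w_l) lX in vX.
have dec k : exists cw : Qp * K, cw.2 \in <<X>>%VS /\ x k = cw.1 *: v + cw.2.
  have := xX k; rewrite span_cons => /memv_addP[_ /vlineP[c ->] [w wX ->]].
  by exists (c, w).
have /choice[cw cwP] := dec.
have le_c c w : w \in <<X>>%VS -> absQp c * d <= abs (c *: v + w).
  move=> wX; have [->|c0] := eqVneq c 0.
    by rewrite abs0 mul0r absval_ge0.
  have -> : c *: v + w = c%:A * (v - (- c^-1 *: w)).
    by rewrite scaleNr opprK mulrDr mulr_algl mulr_algl scalerA divff// scale1r.
  rewrite absvalM (unram_extends KP) ler_pM2l ?abs_gt0// dist//.
  by rewrite memvZ.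
have c_cauchy : abs_cauchy absQp (fun k => (cw k).1).
  move=> eps eps0; have [N xN] := x_cauchy _ (mulr_gt0 eps0 d0).
  exists N => k l Nk Nl; rewrite -(ltr_pM2r d0).
  apply: le_lt_trans (xN _ _ Nk Nl).
  have [kX xkE] := cwP k; have [lX xlE] := cwP l.
  have -> : x k - x l = ((cw k).1 - (cw l).1) *: v + ((cw k).2 - (cw l).2).
    by rewrite xkE xlE scalerBl opprD addrACA.
  by rewrite le_c// rpredB.
have [c c_cvg] := Qp_complete QpP c_cauchy.
have cv_cvg : abs_cvg abs (fun k => (cw k).1 *: v) (c *: v).
  have : abs_cvg abs (fun k => (cw k).1%:A) c%:A.
    move=> eps /c_cvg[N cN]; exists N => k Nk.
    by rewrite -scalerBl (unram_extends KP) cN.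
  move=> /abs_cvgM /(_ (abs_cvg_cst abs v)).
  by congr abs_cvg; [apply/funext => k|]; rewrite mulr_algl.
have w_cauchy : abs_cauchy abs (fun k => (cw k).2).
  move=> eps eps0; have [N xN] := x_cauchy _ eps0; have [M cM] := cv_cvg _ eps0.
  exists (maxn N M) => k l; rewrite !geq_max => /andP[Nk Mk] /andP[Nl Ml].
  have [_ xkE] := cwP k; have [_ xlE] := cwP l.
  have -> : (cw k).2 - (cw l).2 = (x k - x l) -
      (((cw k).1 *: v - c *: v) - ((cw l).1 *: v - c *: v)).
    by rewrite xkE xlE; ring.
  by rewrite abs_ltB ?xN// abs_ltB ?cM.
have [w wX w_cvg] := IHX _ (fun k => proj1 (cwP k)) w_cauchy.
exists (c *: v + w).
  by rewrite span_cons memv_add// memvZ// memv_line.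
have := abs_cvgD cv_cvg w_cvg.
by congr abs_cvg; apply/funext => k; case: (cwP k).
Qed.

Lemma complete_ext (x : nat -> K) : abs_cauchy abs x -> exists l, abs_cvg abs
  x l.
Proof.
move=> x_cauchy.
have xV k : x k \in <<vbasis {:K}>>%VS.
  by rewrite (span_basis (vbasisP _)) memvf.
by have [l _ xl] := complete_span xV x_cauchy; exists l.
Qed.

End UnramifiedExtension.

(** * Invariance *)

Section QuadraticDerivative.
Variables (R : realType) (K : fieldType) (abs : nonarch_absval R K) (n p : nat).
Hypotheses (pr_p : prime p) (abs_pE : abs p%:R = p%:R^-1).
Variables (i : 'I_n) (z : 'rV[K]_n).
Implicit Types F G : 'rV[K]_n -> K.

Local Notation shift h := (z + h *: delta_mx 0 i).

(** Stronger than differentiability and stable under sums and products. Both [Ilim] and the analytic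
    coefficients satisfy it. *)
Definition quad_deriv F l := exists C d : R, [/\ 0 <= C, 0 < d &
  forall h : K, abs h <= d -> abs (F (shift h) - F z - h * l) <= C * abs h ^+
    2].

Lemma quad_deriv_local F G l d : 0 < d -> F z = G z ->
  (forall h, abs h <= d -> F (shift h) = G (shift h)) ->
  quad_deriv G l -> quad_deriv F l.
Proof.
move=> d0 FGz FG [C [d' [C0 d'0 GC]]]; exists C, (Num.min d d'); split=> //.
  by rewrite lt_min d0.
by move=> h; rewrite le_min => /andP[hd hd']; rewrite FG// FGz GC.
Qed.

Lemma quad_derivD F G l l' : quad_deriv F l -> quad_deriv G l' ->
  quad_deriv (fun y => F y + G y) (l + l').
Proof.
move=> [C [d [C0 d0 FC]]] [C' [d' [C'0 d'0 GC]]].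
exists (C + C'), (Num.min d d'); split; first exact: addr_ge0.
  by rewrite lt_min d0.
move=> h; rewrite le_min => /andP[hd hd'].
have -> : F (shift h) + G (shift h) - (F z + G z) - h * (l + l') =
  (F (shift h) - F z - h * l) + (G (shift h) - G z - h * l') by ring.
have h2 : 0 <= abs h ^+ 2 by rewrite exprn_ge0 ?absval_ge0.
apply: abs_leD.
  by rewrite (le_trans (FC h hd))// ler_wpM2r// lerDl.
by rewrite (le_trans (GC h hd'))// ler_wpM2r// lerDr.
Qed.

Lemma quad_derivM F G l l' : quad_deriv F l -> quad_deriv G l' ->
  quad_deriv (fun y => F y * G y) (l * G z + F z * l').
Proof.
move=> [C [d [C0 d0 FC]]] [C' [d' [C'0 d'0 GC]]].
have abs0' := absval_ge0 abs.
(* [M] and [M'] bound [|G(z + h)|] and [|F(z) + h l|] for small [h]; [D] adds up the constants of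
   the three error terms. *)
pose M := abs (G z) + abs l' + C'; pose M' := abs (F z) + abs l.
have M0 : 0 <= M by rewrite !addr_ge0.
have M'0 : 0 <= M' by rewrite addr_ge0.
pose D := C * M + M' * C' + abs l * abs l'.
exists D, (Num.min 1 (Num.min d d')); split.
- by rewrite !addr_ge0 ?mulr_ge0.
- by rewrite !lt_min ltr01 d0.
move=> h; rewrite !le_min => /and3P[h1 hd hd'].
have h2 : 0 <= abs h ^+ 2 by rewrite exprn_ge0.
have h21 : abs h ^+ 2 <= 1 by rewrite exprn_ile1.
have GM : abs (G (shift h)) <= M.
  have -> : G (shift h) = (G (shift h) - G z - h * l') + (G z + h * l') by ring.
  apply: abs_leD.
    apply: le_trans (GC h hd') _; rewrite /M -[leLHS]add0r lerD ?addr_ge0//.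
    exact: ler_piMr.
  apply: abs_leD; first by rewrite /M -addrA lerDl addr_ge0.
  rewrite absvalM (@le_trans _ _ (abs l'))//; first exact: ler_piMl.
  by rewrite /M addrAC lerDr addr_ge0.
have FM : abs (F z + h * l) <= M'.
  apply: abs_leD; first by rewrite lerDl.
  rewrite absvalM (@le_trans _ _ (abs l))//; first exact: ler_piMl.
  by rewrite lerDr.
have -> : F (shift h) * G (shift h) - F z * G z - h * (l * G z + F z * l') =
  (F (shift h) - F z - h * l) * G (shift h) +
  (F z + h * l) * (G (shift h) - G z - h * l') + h ^+ 2 * (l * l') by ring.
have part x y : abs x <= y * abs h ^+ 2 -> y <= D -> abs x <= D * abs h ^+ 2.
  by move=> xy yD; rewrite (le_trans xy)// ler_wpM2r.
have CM0 : 0 <= C * M by exact: mulr_ge0.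
have MC0 : 0 <= M' * C' by exact: mulr_ge0.
have ll0 : 0 <= abs l * abs l' by exact: mulr_ge0.
apply: abs_leD; first apply: abs_leD.
- apply: (part _ (C * M)); first by rewrite mulrAC abs_leM// FC.
  by rewrite /D -addrA lerDl addr_ge0.
- apply: (part _ (M' * C')); first by rewrite -mulrA abs_leM// GC.
  by rewrite /D addrAC lerDr addr_ge0.
- apply: (part _ (abs l * abs l')); first by rewrite absvalM absX absvalM mulrC.
  by rewrite /D lerDr addr_ge0.
Qed.

Lemma quad_deriv_sum (I : Type) (r : seq I) (F : I -> 'rV[K]_n -> K) l :
  (forall j, quad_deriv (F j) (l j)) ->
  quad_deriv (fun y => \sum_(j <- r) F j y) (\sum_(j <- r) l j).
Proof.
move=> Fl; elim: r => [|j r IHr].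
  exists 0, 1; split=> // h _.
  by rewrite !big_nil mulr0 !subrr abs0 mul0r.
have := quad_derivD (Fl j) IHr; rewrite big_cons; congr quad_deriv.
by apply/funext => y; rewrite big_cons.
Qed.

Lemma quad_deriv_is_pderiv F l : quad_deriv F l -> is_pderiv abs i F z l.
Proof.
move=> [C [d [C0 d0 FC]]] eps eps0.
have C1 : 0 < C + 1 by rewrite ltr_wpDl.
exists (Num.min d (eps / (C + 1))); first by rewrite lt_min d0 divr_gt0.
move=> h h0; rewrite lt_min ltr_pdivlMr// => /andP[hd hC].
have ah0 : 0 < abs h by rewrite abs_gt0.
have -> : (F (shift h) - F z) / h - l = (F (shift h) - F z - h * l) / h.
  by rewrite [RHS]mulrBl [h * l]mulrC mulfK.
rewrite absvalM absV ltr_pdivrMr// (le_lt_trans (FC h (ltW hd)))//.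
rewrite expr2 mulrA ltr_pM2r// (le_lt_trans _ hC)// mulrC ler_wpM2l ?ltW//.
by rewrite ltrDl.
Qed.

Lemma is_pderiv_unique F l l' :
  is_pderiv abs i F z l -> is_pderiv abs i F z l' -> l = l'.
Proof.
move=> Fl Fl'; apply/eqP; rewrite -subr_eq0; apply: contraT => ll'.
have e0 : 0 < abs (l - l') by rewrite abs_gt0.
have [d d0 Fd] := Fl _ e0; have [d' d'0 Fd'] := Fl' _ e0.
have dd'0 : 0 < Num.min d d' by rewrite lt_min d0.
(* [p^N] serves as a nonzero increment of arbitrarily small size. *)
have [N /(_ N (leqnn N))] := abs_pX_small pr_p abs_pE dd'0.
have pN0 : p%:R ^+ N != 0 :> K by rewrite expf_neq0 ?(natp_neq0 pr_p abs_pE).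
rewrite -absX lt_min => /andP[/(Fd _ pN0) lt1 /(Fd' _ pN0) lt2].
by have := abs_ltB lt2 lt1; rewrite opprB addrC addrA subrK ltxx.
Qed.

Lemma quad_deriv_pderiv F l : quad_deriv F l -> pderiv abs i F z = l.
Proof.
move=> /quad_deriv_is_pderiv Fl; apply: xget_unique => // l' Fl'.
exact: is_pderiv_unique Fl' Fl.
Qed.

End QuadraticDerivative.

(** * Restricted power series with denominators *)

Section BoundedTate.
Variables (R : realType) (K : fieldType) (abs : nonarch_absval R K) (n p : nat).
Hypotheses (pr_p : prime p) (abs_pE : abs p%:R = p%:R^-1).
Hypothesis complete : forall x : nat -> K, abs_cauchy abs x ->
  exists l, abs_cvg abs x l.

Local Notation vp := (abs p%:R).
Local Notation W := (unit_polydisc abs n).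
Implicit Types f h : W -> K.

Let p_neq0 : p%:R != 0 :> K := natp_neq0 pr_p abs_pE.

Let pX_tate a : tate p (cst (p%:R ^+ a) : W -> K).
Proof. by apply: tate_cst; rewrite absX exprn_ile1 ?absval_ge0 ?abs_nat. Qed.

(** Restricted power series over [K] rather than over its integers: the coefficients [c_j] of a
    section carry no integrality. *)
Definition bounded_tate f := exists a, tate p (fun w => p%:R ^+ a * f w).

Lemma bounded_tate_ext f h : f =1 h -> bounded_tate f -> bounded_tate h.
Proof. by move=> /funext ->. Qed.

Lemma tate_bounded f : tate p f -> bounded_tate f.
Proof. by move=> tf; exists 0%N; under eq_fun do rewrite mul1r. Qed.

Lemma bounded_tate_cst x : bounded_tate (cst x).
Proof.
have [a ax] := scale_le1 pr_p abs_pE x; exists a.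
exact: (tate_cst n p ax).
Qed.

Lemma bounded_tateM f h : bounded_tate f -> bounded_tate h ->
  bounded_tate (fun w => f w * h w).
Proof.
move=> [a tf] [b th]; exists (a + b)%N; have := tateM tf th.
by congr tate; apply/funext => w; rewrite exprD mulrACA.
Qed.

Lemma bounded_tateB f h : bounded_tate f -> bounded_tate h ->
  bounded_tate (fun w => f w - h w).
Proof.
move=> [a tf] [b th]; exists (a + b)%N.
have := tateB (tateM (pX_tate b) tf) (tateM (pX_tate a) th).
congr tate; apply/funext => w.
rewrite -[LHS]/(p%:R ^+ b * (p%:R ^+ a * f w) - p%:R ^+ a * (p%:R ^+ b * h w)).
by rewrite exprD; ring.
Qed.

Lemma bounded_tateD f h : bounded_tate f -> bounded_tate h ->
  bounded_tate (fun w => f w + h w).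
Proof.
move=> tf th.
have := bounded_tateB tf (bounded_tateM (bounded_tate_cst (-1)) th).
by apply: bounded_tate_ext => w; rewrite /cst mulN1r opprK.
Qed.

Lemma bounded_tateX f k : bounded_tate f -> bounded_tate (fun w => f w ^+ k).
Proof.
move=> tf; elim: k => [|k IHk].
  by apply: bounded_tate_ext (bounded_tate_cst 1) => w.
by apply: bounded_tate_ext (bounded_tateM tf IHk) => w; rewrite exprS.
Qed.

Lemma bounded_tate_sum (I : Type) (r : seq I) (f : I -> W -> K) :
  (forall j, bounded_tate (f j)) -> bounded_tate (fun w => \sum_(j <- r) f j w).
Proof.
move=> tf; elim: r => [|j r IHr].
  by apply: bounded_tate_ext (bounded_tate_cst 0) => w; rewrite big_nil.
by apply: bounded_tate_ext (bounded_tateD (tf j) IHr) => w; rewrite big_cons.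
Qed.

Lemma power_series_sumZ (x : K) (c : {ffun 'I_n -> nat} -> K) u z l :
  power_series_sum abs c u z l ->
  power_series_sum abs (fun k => x * c k) u z (x * l).
Proof.
move=> cl eps eps0; have x1 : 0 < abs x + 1 by rewrite ltr_wpDl ?absval_ge0.
have [J JP] := cl _ (divr_gt0 eps0 x1); exists J => J' /JP.
rewrite ltr_pdivlMr// => lt_eps.
under eq_bigr do rewrite -mulrA; rewrite -mulr_sumr -mulrBr absvalM.
by rewrite (le_lt_trans _ lt_eps)// mulrC ler_wpM2l ?absval_ge0// lerDl.
Qed.

Variables (u : 'rV[K]_n) (pi : K).
Hypothesis pi_neq0 : pi != 0.

Lemma bounded_tate_power_series (F : 'rV[K]_n -> K) :
    bounded_tate (fun w => F (polydisc_pt u pi w)) ->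
  exists c, forall w : W,
    power_series_sum abs c u (polydisc_pt u pi w) (F (polydisc_pt u pi w)).
Proof.
move=> [a taF].
have [c cP] := tate_power_series pr_p abs_pE complete pi_neq0
  (F := fun y => p%:R ^+ a * F y) taF.
exists (fun k => (p%:R ^+ a)^-1 * c k) => w.
have := power_series_sumZ (p%:R ^+ a)^-1 (cP w).
by rewrite mulKf// expf_neq0.
Qed.

(** Chain rule for [y = u + pi w]: an increment [h] of [y] is [h / pi] in [w], whence the radius
    [|pi|] and the factor [|pi|^-2] in the constant. *)
Lemma bounded_tate_deriv (F : 'rV[K]_n -> K) i :
    bounded_tate (fun w => F (polydisc_pt u pi w)) ->
  exists2 F', bounded_tate F' &
    forall w, quad_deriv abs i (polydisc_pt u pi w) F (F' w).
Proof.
move=> [a taF]; have [f' tf' f'P] := tate_deriv pr_p abs_pE complete i taF.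
have pa0 : p%:R ^+ a != 0 :> K by rewrite expf_neq0.
exists (fun w => (p%:R ^+ a * pi)^-1 * f' w).
  by apply: bounded_tateM; [exact: bounded_tate_cst | exact: tate_bounded].
move=> w; exists ((abs (p%:R ^+ a) * abs pi ^+ 2)^-1), (abs pi); split.
- by rewrite invr_ge0 mulr_ge0 ?exprn_ge0 ?absval_ge0.
- by rewrite abs_gt0.
move=> h h_pi; have hpi1 : abs (h / pi) <= 1.
  by rewrite absvalM absV ler_pdivrMr ?mul1r// abs_gt0.
have w'_in : `[< forall j, abs ((val w + (h / pi) *: delta_mx 0 i) 0 j) <= 1 >].
  apply/asboolP => j; rewrite !mxE abs_leD ?unit_polydiscP//.
  by rewrite -[X in _ <= X]mulr1 abs_leM ?abs_nat.
pose w' : W := exist _ (val w + (h / pi) *: delta_mx 0 i) w'_in.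
have w'E : val w' = val w + (h / pi) *: delta_mx 0 i by [].
have ptE : polydisc_pt u pi w' = polydisc_pt u pi w + h *: delta_mx 0 i.
  by rewrite /polydisc_pt w'E scalerDr scalerA mulrCA divff// mulr1 addrA.
have := f'P w w' _ hpi1 w'E; rewrite ptE => le_h.
have -> : F (polydisc_pt u pi w + h *: delta_mx 0 i) - F (polydisc_pt u pi w)
    - h * ((p%:R ^+ a * pi)^-1 * f' w) =
  (p%:R ^+ a)^-1 * (p%:R ^+ a * F (polydisc_pt u pi w + h *: delta_mx 0 i)
    - p%:R ^+ a * F (polydisc_pt u pi w) - h / pi * f' w).
  by field; rewrite pi_neq0 pa0.
have -> : (abs (p%:R ^+ a) * abs pi ^+ 2)^-1 * abs h ^+ 2 =
    abs (p%:R ^+ a)^-1 * abs (h / pi) ^+ 2.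
  by rewrite absvalM !absV invfM exprMn exprVn -mulrA [abs h ^+ 2 * _]mulrC.
exact: abs_leM.
Qed.

End BoundedTate.

(** * Polydiscs and the discrete value group *)

Section Radius.
Variables (R : realType) (K : fieldType) (abs : nonarch_absval R K) (n p : nat).
Hypotheses (pr_p : prime p) (abs_pE : abs p%:R = p%:R^-1).
Hypothesis value_group : forall x : K, x != 0 ->
  exists k : int, abs x = p%:R ^ k.

Local Notation vp := (abs p%:R).

Let vp_gt0 : 0 < vp := abs_p_gt0 pr_p abs_pE.

Let vp_le1 : vp <= 1. Proof. exact: abs_nat. Qed.

(** [k] is the least exponent with [|p|^k < r], and no absolute value lies strictly between [|p|^k]
    and [r]. Since [r <= 1], [k] is positive, which gives [|pi| <= |p|] below. *)
Lemma radius_value_group r : 0 < r <= 1 ->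
  exists2 k, (0 < k)%N & forall x, (abs x < r) = (abs x <= vp ^+ k).
Proof.
move=> /andP[r0 r1]; have [N ltN] := abs_pX_small pr_p abs_pE r0.
have exk : exists k, vp ^+ k < r by exists N; exact: ltN.
case: (ex_minnP exk) => k ltk mink; exists k.
  by rewrite lt0n; apply: contraTneq ltk => ->; rewrite expr0 -leNgt.
move=> x; apply/idP/idP => [x_lt|x_le]; last exact: le_lt_trans ltk.
have [->|x0] := eqVneq x 0; first by rewrite abs0 exprn_ge0// ltW.
have [[j|j] xE] := value_group x0.
  have : 1 <= abs x by rewrite xE -exprnP exprn_ege1// ler1n prime_gt0.
  by move=> /(lt_le_trans (lt_le_trans x_lt r1)); rewrite ltxx.
have xE' : abs x = vp ^+ j.+1 by rewrite xE abs_pE exprVn.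
by rewrite xE'; apply: ler_wiXn2l => //; [exact: ltW | apply: mink;
  rewrite -xE'].
Qed.

Lemma polydisc_param (u : 'rV[K]_n) r : 0 < r <= 1 ->
  exists pi : K, [/\ pi != 0, abs pi <= vp,
    forall w : unit_polydisc abs n, polydisc abs u r (polydisc_pt u pi w) &
    forall z, polydisc abs u r z ->
      exists w : unit_polydisc abs n, z = polydisc_pt u pi w].
Proof.
move=> /radius_value_group[k k0 rE]; exists (p%:R ^+ k).
have pk0 : p%:R ^+ k != 0 :> K by rewrite -(absval_eq0 abs) absX expf_neq0//
  gt_eqF.
split=> //.
- by rewrite absX -[leRHS]expr1; apply: ler_wiXn2l => //; exact: ltW.
- move=> w j; rewrite rE !mxE [u 0 j + _]addrC addrK -absX -[leRHS]mulr1.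
  by rewrite abs_leM// unit_polydiscP.
- move=> z zu.
  have w_in : `[< forall j, abs (((p%:R ^+ k)^-1 *: (z - u)) 0 j) <= 1 >].
    apply/asboolP => j; rewrite !mxE absvalM absV mulrC ler_pdivrMr ?abs_gt0//.
    by rewrite mul1r absX -rE; exact: zu.
  exists (exist _ ((p%:R ^+ k)^-1 *: (z - u)) w_in).
  by rewrite /polydisc_pt /= scalerA divff// scale1r addrC subrK.
Qed.

End Radius.

(** * The covariant derivative of a local section *)

Section Invariance.
Variables (R : realType) (K : fieldType) (abs : nonarch_absval R K).
Variables (p q e g n : nat).
Hypotheses (pr_p : prime p) (odd_p : odd p) (q_gt1 : (1 < q)%N).
Hypotheses (e_gt0 : (0 < e)%N) (e_order : p ^ e = 1 %[mod q]).
Hypotheses (n_def : n = (g * q + 1)%N) (n_lt_pe : (n < p ^ e)%N).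
Hypothesis abs_pE : abs p%:R = p%:R^-1.
Hypothesis complete : forall x : nat -> K, abs_cauchy abs x ->
  exists l, abs_cvg abs x l.
Hypothesis value_group : forall x : K, x != 0 ->
  exists k : int, abs x = p%:R ^ k.

Local Notation vp := (abs p%:R).
Local Notation II := (Ilim p q e g abs).

Lemma quad_deriv_Ilim i (z : 'rV[K]_n) k l :
    D_KZ p q e g abs z -> regular_KZ i z ->
  quad_deriv abs i z (fun y => II y k l)
    ((H_KZ q i z *m II z - q%:R^-1 *: (II z *m conn_mx i z (II z))) k l).
Proof.
move=> zD zi; exists 1, vp; split=> //.
  exact: abs_p_gt0.
move=> h hp; rewrite mul1r.
exact: (Ilim_shift pr_p odd_p q_gt1 e_gt0 e_order n_def n_lt_pe abs_pE
  complete zD zi).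
Qed.

Lemma abs_open_regular i : abs_open abs (@regular_KZ n K i).
Proof.
move=> u ui; pose r := \big[Order.min/1]_(j < n | j != i) abs (u 0 i - u 0 j).
exists r; split.
  rewrite /r; elim/big_ind: _ => // [x y x0 y0|j ji];
    first by rewrite lt_min x0.
  by rewrite abs_gt0 subr_eq0 ui.
move=> z zu j ji; have rj : r <= abs (u 0 i - u 0 j) by exact: bigmin_le_cond.
apply/eqP => zij; have := abs_ltB (zu j) (zu i).
have -> : z 0 j - u 0 j - (z 0 i - u 0 i) = u 0 i - u 0 j by rewrite zij; ring.
by rewrite ltNge rj.
Qed.

Lemma abs_openI (U V : set 'rV[K]_n) :
  abs_open abs U -> abs_open abs V -> abs_open abs (U `&` V).
Proof.
move=> oU oV u [/oU[r [r0 rU]] /oV[r' [r'0 rV]]].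
exists (Num.min r r'); split; first by rewrite lt_min r0.
move=> z zu; split.
  by apply: rU => j; have := zu j; rewrite lt_min => /andP[].
by apply: rV => j; have := zu j; rewrite lt_min => /andP[].
Qed.

Variables (U : set 'rV[K]_n) (i : 'I_n).
Hypotheses (UD : U `<=` D_KZ p q e g abs) (oU : abs_open abs U).
Variable c : 'I_g -> 'rV[K]_n -> K.
Hypothesis c_an : forall j, analytic_on abs U (c j).

(** The matrix [B] is [q^-1] times [conn_mx]. It has no pole on the diagonals, so these coefficients
    are analytic on all of [U]. *)
Definition nabla_coef (j : 'I_g) z := pderiv abs i (c j) z -
  q%:R^-1 * \sum_l conn_mx i z (II z) j l * c l z.

Let coef_param u r : 0 < r <= 1 -> polydisc abs u r `<=` U ->
  exists pi : K, [/\ pi != 0, abs pi <= vp,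
    forall w : unit_polydisc abs n, polydisc abs u r (polydisc_pt u pi w),
    forall z, polydisc abs u r z ->
      exists w : unit_polydisc abs n, z = polydisc_pt u pi w &
    forall j, bounded_tate p
      (fun w : unit_polydisc abs n => c j (polydisc_pt u pi w))].
Proof.
move=> r01 rU; have [pi [pi0 pi_le pi_in pi_onto]] :=
  polydisc_param pr_p abs_pE value_group u r01.
exists pi; split=> // j; have [d dP] := c_an j r01 rU.
exact: (power_series_tate pr_p abs_pE (fun w => dP _ (pi_in w))).
Qed.

Lemma quad_deriv_coef z j : U z ->
  quad_deriv abs i z (c j) (pderiv abs i (c j) z).
Proof.
move=> Uz; have [r [r0 rU]] := oU Uz.
(* Analyticity speaks of radii at most 1 only. *)
have r01 : 0 < Num.min r 1 <= 1 by rewrite lt_min r0 ltr01 ge_min lexx orbT.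
have rU' : polydisc abs z (Num.min r 1) `<=` U.
  move=> y yz; apply: rU => k; have := yz k.
  by rewrite lt_min => /andP[].
have [pi [pi0 _ _ pi_onto ct]] := coef_param r01 rU'.
have [w zE] : exists w : unit_polydisc abs n, z = polydisc_pt z pi w.
  by apply: pi_onto => k; rewrite subrr abs0; case/andP: r01.
have [c' _ c'P] := bounded_tate_deriv pr_p abs_pE complete pi0 i (ct j).
have := c'P w; rewrite -zE => cw.
by rewrite (quad_deriv_pderiv pr_p abs_pE cw).
Qed.

Lemma analytic_nabla_coef j : analytic_on abs U (nabla_coef j).
Proof.
move=> u r r01 rU; have [pi [pi0 pi_le pi_in pi_onto ct]] := coef_param r01 rU.
have uD : D_KZ p q e g abs u.
  by apply/UD/rU => k; rewrite subrr abs0; case/andP: r01.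
pose pt (w : unit_polydisc abs n) := polydisc_pt u pi w.
have It k l : bounded_tate p (fun w => II (pt w) k l).
  exact/tate_bounded/(tate_Ilim pr_p odd_p q_gt1 e_gt0 e_order n_def n_lt_pe
    abs_pE complete).
have zt k : bounded_tate p (fun w => pt w 0 k).
  have := bounded_tateD pr_p abs_pE (bounded_tate_cst n pr_p abs_pE (u 0 k))
    (bounded_tateM (bounded_tate_cst n pr_p abs_pE pi)
      (tate_bounded (tate_coord abs p k))).
  by apply: bounded_tate_ext => w; rewrite !mxE.
have Ct k l : bounded_tate p (fun w => conn_mx i (pt w) (II (pt w)) k l).
  have := bounded_tateD pr_p abs_pE
    (bounded_tateM (bounded_tateX pr_p abs_pE k (zt i)) (It i l))
    (* The test depends on the indices alone, so it is decided before [w] varies. *)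
    (if (l < k)%N as b return bounded_tate p
         (fun w => if b then pt w 0 i ^+ (k - l.+1) else 0)
     then bounded_tateX pr_p abs_pE (k - l.+1) (zt i)
     else bounded_tate_cst n pr_p abs_pE 0).
  by apply: bounded_tate_ext => w; rewrite [RHS]mxE; case: ifP.
have dt : bounded_tate p (fun w => pderiv abs i (c j) (pt w)).
  have [c' c't c'P] := bounded_tate_deriv pr_p abs_pE complete pi0 i (ct j).
  apply: bounded_tate_ext c't => w.
  by rewrite (quad_deriv_pderiv pr_p abs_pE (c'P w)).
have coef_t : bounded_tate p (fun w => nabla_coef j (pt w)).
  apply: (bounded_tateB dt); apply: bounded_tateM.
    exact: bounded_tate_cst.
  apply: bounded_tate_sum => // l.
  by apply: bounded_tateM.
have [d dP] := bounded_tate_power_series pr_p abs_pE complete pi0 coef_t.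
by exists d => z /pi_onto[w ->].
Qed.

Lemma nabla_section (s : 'rV[K]_n -> 'cV[K]_n) z :
    (forall z, U z -> s z = \sum_j c j z *: col j (II z)) ->
    U z -> regular_KZ i z ->
  nabla_KZ q abs i s z = \sum_j nabla_coef j z *: col j (II z).
Proof.
move=> sE Uz zi.
have sumE (x : 'I_g -> K) y : \sum_j x j *: col j (II y) = II y *m \col_j x j.
  apply/colP => k; rewrite summxE mxE; apply: eq_bigr => j _.
  by rewrite !mxE mulrC.
pose C := \col_j c j z; pose dC := \col_j pderiv abs i (c j) z.
pose DI := H_KZ q i z *m II z - q%:R^-1 *: (II z *m conn_mx i z (II z)).
have dsE : \col_k pderiv abs i (fun y => s y k 0) z = DI *m C + II z *m dC.
  apply/colP => k; rewrite mxE; apply: (quad_deriv_pderiv pr_p abs_pE).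
  have [r [r0 rU]] := oU Uz.
  (* [s] equals the sum on [U] only; the closed ball of radius [r / 2] lies in the open polydisc of
     radius [r]. *)
  apply: (@quad_deriv_local _ _ _ _ _ _ _ (fun y => \sum_j II y k j * c j y) _
    (r / 2)).
  - by rewrite divr_gt0.
  - by rewrite sE// sumE mxE; apply: eq_bigr => j _; rewrite [X in _ * X]mxE.
  - move=> h h_r; rewrite sE ?sumE.
      by rewrite mxE; apply: eq_bigr => j _; rewrite [X in _ * X]mxE.
    apply: rU => l; rewrite !mxE [z 0 l + _]addrC addrK.
    apply: (@le_lt_trans _ _ (r / 2)); last by rewrite ltr_pdivrMr// ltr_pMr//
      ltr1n.
    by rewrite (le_trans _ h_r)// absvalM ler_piMr ?absval_ge0 ?abs_nat.
  have -> : (DI *m C + II z *m dC) k 0 =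
      \sum_j (DI k j * c j z + II z k j * pderiv abs i (c j) z).
    rewrite mxE big_split; congr (_ + _); rewrite mxE.
      by apply: eq_bigr => j _; rewrite [X in _ * X]mxE.
    by apply: eq_bigr => j _; rewrite [X in _ * X]mxE.
  apply: quad_deriv_sum => j; apply: quad_derivM.
    by apply: quad_deriv_Ilim => //; exact: UD.
  exact: quad_deriv_coef.
have coefE : \col_j nabla_coef j z = dC - q%:R^-1 *: (conn_mx i z (II z) *m C).
  apply/colP => j; transitivity (dC j 0 - q%:R^-1 * (conn_mx i z (II z) *m C)
    j 0).
    rewrite [LHS]mxE [dC j 0]mxE; congr (_ - _ * _); rewrite [RHS]mxE.
    by apply: eq_bigr => l _; rewrite [C l 0]mxE.
  by move: (_ *m C) dC {dsE} => x y; rewrite !mxE.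
(* The term [H I C] of the derivative cancels against [H s], and what remains is [I] applied to a
   column. *)
rewrite /nabla_KZ dsE sE// !sumE coefE -/C /DI mulmxBl -!scalemxAl !mulmxA.
by rewrite mulmxBr -scalemxAr mulmxA addrC addrA addKr addrC.
Qed.

End Invariance.

Theorem theorem6p10
  (R : realType) (p q e g n m : nat)
  (p_prime : prime p) (q_prime : prime q) (q_lt_p : (q < p)%N) (p_odd : odd p)
  (e_gt0 : (0 < e)%N) (e_order : p ^ e = 1 %[mod q])
  (e_min : forall k : nat, (0 < k)%N -> p ^ k = 1 %[mod q] -> (e <= k)%N)
  (g_gt0 : (0 < g)%N) (n_def : n = (g * q + 1)%N)
  (n_lt_pe : (n < p ^ e)%N) (n_le_p : (n + q - 2 <= p)%N)
  (m_gt0 : (0 < m)%N) (deg_lt_pm : (deg_detA p q e g < p ^ m)%N)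
  (Qp : fieldType) (absQp : nonarch_absval R Qp) (QpP : is_Qp p absQp)
  (K : fieldExtType Qp) (abs : nonarch_absval R K)
  (KP : is_unramified_ext absQp abs m)
  (U : set 'rV[K]_n) (s : 'rV[K]_n -> 'cV[K]_n)
  (s_section : local_section p q e g abs U s)
  (i : 'I_n) :
  local_section p q e g abs (U `&` regular_KZ i) (nabla_KZ q abs i s).
Proof.
have abs_pE := abs_p p_prime QpP KP; have complete := complete_ext QpP KP.
have vg := value_group QpP KP; have q_gt1 := prime_gt1 q_prime.
case: s_section => UD oU [c [c_an sE]]; split.
- by move=> z [/UD].
- by apply: abs_openI => //; exact: abs_open_regular.
exists (nabla_coef abs p q e i c); split=> [j|z [Uz zi]].
  have an := analytic_nabla_coef p_prime p_odd q_gt1 e_gt0 e_order n_def n_lt_pe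
    abs_pE complete vg i UD c_an j.
  by move=> u r r01 rU; apply: an => // z /rU[].
exact: (nabla_section p_prime p_odd q_gt1 e_gt0 e_order n_def n_lt_pe
  abs_pE complete vg UD oU c_an sE).
Qed.
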